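(* Let $\gamma$ be a smooth real-valued function of $t$ and $V=i\gamma(t)x$. The maximal Lie invariance algebra $\mathfrak g_V$ of the equation $i\psi_t+\psi_{xx}+i\gamma(t)x\psi=0$ is spanned by the vector fields $D_{\gamma}(\tau)$, $G(1)+\rho^1I$, $G(t)+\rho^2I$, $M$, $I$, $Z(\eta^0)$, where $D_\gamma(\tau):=\tau\partial_t+\frac12\tau_tx\partial_x+\frac18\tau_{tt}x^2M-\frac14\tau_tI$, the parameter $\tau$ runs through the set of polynomials in $t$ of degree at most two satisfying $(\gamma|\tau|^{3/2})_t=0$, $\rho^1=-\int\gamma(t)\,dt$, $\rho^2=-\int t\gamma(t)\,dt$, and $\eta^0$ runs through the solution set of the equation.
   Context: $\psi$ is a complex-valued function of real $t,x$; $\psi^*$ is treated as an additional dependent variable and vector fields act on the space of $(t,x,\psi,\psi^* )$. Notation: $M=i\psi\partial_\psi-i\psi^*\partial_{\psi^*}$, $I=\psi\partial_\psi+\psi^*\partial_{\psi^*}$, $G(\chi)=\chi\partial_x+\frac12\chi_txM$, $Z(\eta)=\eta\partial_\psi+\eta^*\partial_{\psi^*}$. *)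

(* Defs.v *)
From HB Require Import structures.
From mathcomp Require Import all_boot all_order all_algebra.
From mathcomp Require Import all_classical all_reals all_analysis.
Set Implicit Arguments. Unset Strict Implicit. Unset Printing Implicit Defensive.
Import Order.TTheory GRing.Theory Num.Theory.
Import numFieldNormedType.Exports.
Local Open Scope ring_scope.

Section Defs.
Variable R : realType.

Fixpoint Ck (n k : nat) (f : 'rV[R]_n -> R) : Prop :=
  match k with
  | 0 => continuous f
  | k'.+1 => [/\ continuous f,
               (forall (i : 'I_n) (p : 'rV[R]_n), derivable f p (delta_mx 0 i)) &
               (forall i : 'I_n, Ck k' ('D_(delta_mx 0 i) f))]
  end.
Definition smoothn n (f : 'rV[R]_n -> R) := forall k, Ck k f.

Definition cmp n (p : 'rV[R]_n.+1) (i : nat) : R := p ord0 (inord i).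
Definition smooth1 (f : R -> R) := smoothn (fun p : 'rV[R]_1 => f (cmp p 0)).
Definition smooth2 (f : R -> R -> R) :=
  smoothn (fun p : 'rV[R]_2 => f (cmp p 0) (cmp p 1)).
Definition smooth4 (f : R -> R -> R -> R -> R) :=
  smoothn (fun p : 'rV[R]_4 => f (cmp p 0) (cmp p 1) (cmp p 2) (cmp p 3)).

Definition dt (f : R -> R -> R) : R -> R -> R := fun t x => derive1 (fun s => f s x) t.
Definition dx (f : R -> R -> R) : R -> R -> R := fun t x => derive1 (fun y => f t y) x.

(* Q = tau d_t + xi d_x + eta d_psi + eta^* d_psi^*, written in the real
   coordinates (t, x, u, v), psi = u + i v :
   Q = tau d_t + xi d_x + (Re eta) d_u + (Im eta) d_v.
   All coefficients are real functions of (t, x, u, v). *)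
Record vfield := VF {
  vf_t : R -> R -> R -> R -> R;
  vf_x : R -> R -> R -> R -> R;
  vf_u : R -> R -> R -> R -> R;
  vf_v : R -> R -> R -> R -> R }.

Definition smooth_vf (Q : vfield) :=
  [/\ smooth4 (vf_t Q), smooth4 (vf_x Q), smooth4 (vf_u Q) & smooth4 (vf_v Q)].

Definition vf_zero : vfield :=
  VF (fun _ _ _ _ => 0) (fun _ _ _ _ => 0) (fun _ _ _ _ => 0) (fun _ _ _ _ => 0).
Definition vf_add (P Q : vfield) : vfield :=
  VF (fun t x u v => vf_t P t x u v + vf_t Q t x u v)
     (fun t x u v => vf_x P t x u v + vf_x Q t x u v)
     (fun t x u v => vf_u P t x u v + vf_u Q t x u v)
     (fun t x u v => vf_v P t x u v + vf_v Q t x u v).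
Definition vf_scale (c : R) (Q : vfield) : vfield :=
  VF (fun t x u v => c * vf_t Q t x u v) (fun t x u v => c * vf_x Q t x u v)
     (fun t x u v => c * vf_u Q t x u v) (fun t x u v => c * vf_v Q t x u v).
Definition vf_mulf (f : R -> R) (Q : vfield) : vfield :=
  VF (fun t x u v => f t * vf_t Q t x u v) (fun t x u v => f t * vf_x Q t x u v)
     (fun t x u v => f t * vf_u Q t x u v) (fun t x u v => f t * vf_v Q t x u v).

Definition in_span (S : vfield -> Prop) (Q : vfield) : Prop :=
  exists s : seq (R * vfield),
    foldr (fun p P => S p.2 /\ P) True s /\
    Q = foldr (fun p acc => vf_add (vf_scale p.1 p.2) acc) vf_zero s.

(* with psi = u + i v:  Re: -v_t + u_xx - gamma x v = 0,
                        Im:  u_t + v_xx + gamma x u = 0 *)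
Definition Delta1 (gamma : R -> R) (u v : R -> R -> R) (t x : R) : R :=
  - dt v t x + dx (dx u) t x - gamma t * x * v t x.
Definition Delta2 (gamma : R -> R) (u v : R -> R -> R) (t x : R) : R :=
  dt u t x + dx (dx v) t x + gamma t * x * u t x.

Definition is_solution (gamma : R -> R) (u v : R -> R -> R) : Prop :=
  forall t x, Delta1 gamma u v t x = 0 /\ Delta2 gamma u v t x = 0.

Definition char_u (Q : vfield) (u v : R -> R -> R) : R -> R -> R := fun t x =>
  vf_u Q t x (u t x) (v t x) - vf_t Q t x (u t x) (v t x) * dt u t x
  - vf_x Q t x (u t x) (v t x) * dx u t x.
Definition char_v (Q : vfield) (u v : R -> R -> R) : R -> R -> R := fun t x =>
  vf_v Q t x (u t x) (v t x) - vf_t Q t x (u t x) (v t x) * dt v t x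
  - vf_x Q t x (u t x) (v t x) * dx v t x.

(* prolonged coefficients  phi^J = D_J Q_u + tau u_{J t} + xi u_{J x} *)
Definition pr_t (Q : vfield) (u v w : R -> R -> R) (c : R -> R -> R) (t x : R) : R :=
  dt c t x + vf_t Q t x (u t x) (v t x) * dt (dt w) t x
           + vf_x Q t x (u t x) (v t x) * dx (dt w) t x.
Definition pr_xx (Q : vfield) (u v w : R -> R -> R) (c : R -> R -> R) (t x : R) : R :=
  dx (dx c) t x + vf_t Q t x (u t x) (v t x) * dt (dx (dx w)) t x
                + vf_x Q t x (u t x) (v t x) * dx (dx (dx w)) t x.

Definition prQ_Delta1 (gamma : R -> R) (Q : vfield) (u v : R -> R -> R) (t x : R) : R :=
  let U := u t x in let V := v t x in
  - pr_t Q u v v (char_v Q u v) t x + pr_xx Q u v u (char_u Q u v) t x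
  - derive1 gamma t * vf_t Q t x U V * x * V
  - gamma t * vf_x Q t x U V * V
  - gamma t * x * vf_v Q t x U V.
Definition prQ_Delta2 (gamma : R -> R) (Q : vfield) (u v : R -> R -> R) (t x : R) : R :=
  let U := u t x in let V := v t x in
  pr_t Q u v u (char_u Q u v) t x + pr_xx Q u v v (char_v Q u v) t x
  + derive1 gamma t * vf_t Q t x U V * x * U
  + gamma t * vf_x Q t x U V * U
  + gamma t * x * vf_u Q t x U V.

(* infinitesimal invariance criterion: pr^(2)Q Delta = 0 on the manifold Delta = 0
   of the jet space (every jet is realized by a smooth, e.g. polynomial, w) *)
Definition lie_symmetry (gamma : R -> R) (Q : vfield) : Prop :=
  smooth_vf Q /\
  forall u v : R -> R -> R, smooth2 u -> smooth2 v ->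
  forall t x, Delta1 gamma u v t x = 0 -> Delta2 gamma u v t x = 0 ->
    prQ_Delta1 gamma Q u v t x = 0 /\ prQ_Delta2 gamma Q u v t x = 0.

(* M = i psi d_psi - i psi^* d_psi^*  :  -v d_u + u d_v *)
Definition M_vf : vfield :=
  VF (fun _ _ _ _ => 0) (fun _ _ _ _ => 0) (fun _ _ _ v => - v) (fun _ _ u _ => u).
(* I = psi d_psi + psi^* d_psi^*  :  u d_u + v d_v *)
Definition I_vf : vfield :=
  VF (fun _ _ _ _ => 0) (fun _ _ _ _ => 0) (fun _ _ u _ => u) (fun _ _ _ v => v).
Definition G_vf (chi : R -> R) : vfield :=
  vf_add (VF (fun _ _ _ _ => 0) (fun t _ _ _ => chi t) (fun _ _ _ _ => 0) (fun _ _ _ _ => 0))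
         (VF (fun t x u v => 2^-1 * derive1 chi t * x * vf_t M_vf t x u v)
             (fun t x u v => 2^-1 * derive1 chi t * x * vf_x M_vf t x u v)
             (fun t x u v => 2^-1 * derive1 chi t * x * vf_u M_vf t x u v)
             (fun t x u v => 2^-1 * derive1 chi t * x * vf_v M_vf t x u v)).
(* Z(eta) = eta d_psi + eta^* d_psi^*, eta = a + i b *)
Definition Z_vf (a b : R -> R -> R) : vfield :=
  VF (fun _ _ _ _ => 0) (fun _ _ _ _ => 0) (fun t x _ _ => a t x) (fun t x _ _ => b t x).
Definition D_vf (tau : {poly R}) : vfield :=
  let tt1 t := (deriv tau).[t] in let tt2 t := (derivn 2 tau).[t] in
  VF (fun t _ _ _ => tau.[t])
     (fun t x _ _ => 2^-1 * tt1 t * x)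
     (fun t x u v => 8^-1 * tt2 t * x ^+ 2 * (- v) - 4^-1 * tt1 t * u)
     (fun t x u v => 8^-1 * tt2 t * x ^+ 2 * u - 4^-1 * tt1 t * v).

Definition admissible_tau (gamma : R -> R) (tau : {poly R}) : Prop :=
  (size tau <= 3)%N /\
  forall t : R, is_derive t 1 (fun s => gamma s * `|tau.[s]| `^ (3 / 2)) 0.

Definition gens (gamma rho1 rho2 : R -> R) (Q : vfield) : Prop :=
  (exists tau, admissible_tau gamma tau /\ Q = D_vf tau) \/
  Q = vf_add (G_vf (fun _ => 1)) (vf_mulf rho1 I_vf) \/
  Q = vf_add (G_vf id) (vf_mulf rho2 I_vf) \/
  Q = M_vf \/ Q = I_vf \/
  (exists a b, [/\ smooth2 a, smooth2 b, is_solution gamma a b & Q = Z_vf a b]).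

End Defs.

(* Main.v *)
(* On the jet space the invariance criterion is polynomial in the derivatives of
   u and v that remain free once u_t and v_t are eliminated through the equation.
   Comparing coefficients gives tau = tau(t), xi_x = tau_t / 2 and coefficients
   of d_u, d_v of the form r u - S v + a, S u + r v + b with r = r(t) and
   S_x = xi_t / 2. For such a field the criterion collapses to S_t = 0, to a scalar
   equation W = 0 and to the equation itself for (a, b). From S_t = 0 one gets
   xi_tt = 0 and tau_ttt = 0, so tau is quadratic and xi - tau_t x / 2 is affine in t.
   As a polynomial of degree one in x, W = 0 says that r is the stated primitive and
   that tau gamma_t + (3/2) tau_t gamma = 0, that is, (gamma |tau|^(3/2))_t = 0.
   The chain rule for C^1 functions and the symmetry of second derivatives are
   proved from partial derivatives by the mean value theorem. *)
Require Import Defs.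
From HB Require Import structures.
From mathcomp Require Import all_boot all_order all_algebra.
From mathcomp Require Import all_classical all_reals all_analysis.
From mathcomp Require Import ring lra.
Set Implicit Arguments.
Unset Strict Implicit.
Unset Printing Implicit Defensive.
Import Order.TTheory GRing.Theory Num.Theory.
Import numFieldNormedType.Exports.
Local Open Scope ring_scope.
Local Open Scope classical_set_scope.

(** * The chain rule along a curve *)

(** Both sides of the equivalence are matched with one explicit parametrised family, [normal_form].
    The condition (gamma |tau|^(3/2))_t = 0 is not visibly linear in tau, so the family is cut out
    by the linear equation [classifying] instead, which makes closure under linear combinations
    immediate. The delicate point is the passage between the two conditions: at a zero of tau the
    derivative of gamma |tau|^(3/2) vanishes whatever gamma is, so the linear equation cannot be
    read off there pointwise. The other obstacle is that invariance is stated with functions u, v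
    and with characteristics, whose prolongation contains third derivatives. These cancel, and what
    remains depends on finitely many derivatives at one point, which polynomials realize freely. The
    equation S_t = 0 acts through cross derivatives: S_x = xi_t / 2 gives xi_tt = 2 S_tx = 0, and
    then xi_x = tau_t / 2 gives tau_ttt = 2 xi_ttx = 0. *)

Lemma rV_cvgP (R : realType) n (T : Type) (F : set_system T) (FF : Filter F)
    (f : T -> 'rV[R]_n) (l : 'rV[R]_n) :
  (forall j, f x ord0 j @[x --> F] --> l ord0 j) -> f x @[x --> F] --> l.
Proof.
move=> h; apply/cvgrPdist_le => /= e e0; near=> x.
rewrite /Num.Def.normr/= mx_normrE (bigmax_le _ (ltW e0))//= => -[i j] _.
rewrite !mxE/= (ord1 i); move: j; near: x; apply: filter_forall => j.
by move: (h j) => /cvgrPdist_le /(_ _ e0).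
Unshelve. all: by end_near. Qed.

Section Limits.
Context {R : realType} {T : Type} {F : set_system T} {FF : Filter F}.
Implicit Types f g : T -> R.
Lemma rcvgD f g (a b : R) : f x @[x --> F] --> a -> g x @[x --> F] --> b ->
  f x + g x @[x --> F] --> a + b.
Proof. exact: cvgD. Qed.
Lemma rcvgB f g (a b : R) : f x @[x --> F] --> a -> g x @[x --> F] --> b ->
  f x - g x @[x --> F] --> a - b.
Proof. exact: cvgB. Qed.
Lemma rcvgM f g (a b : R) : f x @[x --> F] --> a -> g x @[x --> F] --> b ->
  f x * g x @[x --> F] --> a * b.
Proof. exact: cvgM. Qed.
End Limits.

Lemma is_derive_line (R : realType) n (F : 'rV[R]_n -> R) (p e : 'rV[R]_n) (s : R) :
  derivable F (s *: e + p) e ->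
  is_derive s 1 (fun s : R => F (s *: e + p)) ('D_e F (s *: e + p)).
Proof.
move=> dF.
have E : (fun h : R => h^-1 *: (F ((h *: (1 : R) + s) *: e + p) - F (s *: e + p))) =
    (fun h => h^-1 *: (F (h *: e + (s *: e + p)) - F (s *: e + p))).
  by apply/funext => h; rewrite scalerDl -addrA [h *: 1]mulr1.
by apply: DeriveDef; rewrite /derivable /derive /= E.
Qed.

(** The bound by [|a|], valid for either sign of the increment, is what later squeezes the
    intermediate parameter to 0. *)
Lemma MVT_line (R : realType) n (F : 'rV[R]_n -> R) (p e : 'rV[R]_n) (a : R) :
  (forall q, derivable F q e) ->
  exists2 s : R, `|s| <= `|a| & F (a *: e + p) - F p = 'D_e F (s *: e + p) * a.
Proof.
move=> dF; pose g (s : R) := F (s *: e + p).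
have dg (s : R) : is_derive s 1 g ('D_e F (s *: e + p)) by apply: is_derive_line.
have cg x y : {within `[x, y], continuous g}.
  apply: continuous_subspaceT => z; apply: differentiable_continuous.
  by apply/derivable1_diffP.
have g0 : g 0 = F p by rewrite /g scale0r add0r.
have [a0|a0] := leP 0 a.
- have [s] := MVT_segment a0 (fun x _ => dg x) (cg _ _).
  rewrite in_itv /= => /andP[s0 sa]; rewrite g0 subr0 => E.
  by exists s => //; rewrite !ger0_norm.
- have [s] := MVT_segment (ltW a0) (fun x _ => dg x) (cg _ _).
  rewrite in_itv /= => /andP[s0 sa]; rewrite g0 sub0r => E.
  exists s; first by rewrite !ler0_norm ?lerN2 // ltW.
  by rewrite -opprB E mulrN opprK.
Qed.

(* The increment of F along the curve is telescoped over the points whose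
   coordinates of index less than i are those of c (s + h), the others those of c s. *)
Lemma is_derive_curve (R : realType) n (F : 'rV[R]_n -> R) (c : R -> 'rV[R]_n) (s : R) :
  (forall i p, derivable F p (delta_mx 0 i)) ->
  (forall i, continuous ('D_(delta_mx 0 i) F)) ->
  derivable c s 1 ->
  is_derive s 1 (fun h => F (c h))
    (\sum_i 'D_(delta_mx 0 i) F (c s) * 'D_1 (fun h => c h 0 i) s).
Proof.
move=> dF cF dc.
have dci i : derivable (fun h => c h 0 i) s 1.
  by have [H _] := derivable_mxP c s 1; exact: H dc 0 i.
pose q (i : nat) (h : R) : 'rV[R]_n :=
  \row_j if (j < i)%N then c (h + s) 0 j else c s 0 j.
pose a (i : 'I_n) h := c (h + s) 0 i - c s 0 i.
have qS (i : 'I_n) h : q i.+1 h = a i h *: delta_mx 0 i + q i h.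
  apply/rowP => j; rewrite !mxE /= ltnS eq_sym.
  have [->|ij] := eqVneq i j; first by rewrite leqnn ltnn mulr1 subrK.
  rewrite mulr0 add0r leq_eqVlt.
  by have -> : (nat_of_ord j == i) = false by apply/negbTE; rewrite eq_sym.
(* The mean value theorem gives an intermediate point for each [h] separately; choice turns these
   points into functions of [h] whose limits can be taken. *)
have /choice[xi xiP] (ih : 'I_n * R) : exists x : R, `|x| <= `|a ih.1 ih.2| /\
    F (q ih.1.+1 ih.2) - F (q ih.1 ih.2) =
    'D_(delta_mx 0 ih.1) F (x *: delta_mx 0 ih.1 + q ih.1 ih.2) * a ih.1 ih.2.
  case: ih => i h /=.
  have [x x1 x2] := MVT_line (q i h) (a i h) (dF i).
  by exists x; rewrite qS.
have q0 h : q 0%N h = c s by apply/rowP => j; rewrite mxE.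
have qn h : q n h = c (h + s) by apply/rowP => j; rewrite mxE ltn_ord.
have tele h : F (c (h + s)) - F (c s) = \sum_(i < n) (F (q i.+1 h) - F (q i h)).
  by rewrite -qn -(q0 h) -(telescope_sumr (fun i => F (q i h)) (leq0n n)) big_mkord.
have shift0 : (h + s) @[h --> (0 : R)] --> s.
  rewrite -[X in _ --> X]add0r; apply: (@cvgD _ R^o); first exact: cvg_id.
  exact: cvg_cst.
have cci (i : 'I_n) : {for s, continuous (fun h => c h 0 i)}.
  by apply: differentiable_continuous; apply/derivable1_diffP.
have acvg i : a i h @[h --> 0^'] --> 0.
  have h1 : c (h + s) 0 i @[h --> 0] --> c s 0 i.
    exact: (cvg_comp (fun h => h + s) (fun x => c x 0 i) shift0 (cci i)).
  have := rcvgB h1 (cvg_cst (c s 0 i)).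
  rewrite subrr => h2; apply: cvg_within_filter. exact: h2.
have xcvg i : xi (i, h) @[h --> 0^'] --> 0.
  have n0 : `|a i h| @[h --> 0^'] --> 0.
    have : `|a i h| @[h --> 0^'] --> `|0 : R| by apply: cvg_norm.
    by rewrite normr0.
  have n1 : - `|a i h| @[h --> 0^'] --> 0.
    have : - `|a i h| @[h --> 0^'] --> - (0 : R) by apply: cvgN.
    by rewrite oppr0.
  apply: (@squeeze_cvgr _ _ _ _ (fun h => - `|a i h|) (fun h => `|a i h|)) => //.
  by near=> h; rewrite -ler_norml; have [] := xiP (i, h).
have qcvg (i : 'I_n) : xi (i, h) *: delta_mx 0 i + q i h @[h --> 0^'] --> c s.
  apply: rV_cvgP => j; under eq_cvg do rewrite !mxE /=.
  have qj : (if (j < i)%N then c (h + s) 0 j else c s 0 j) @[h --> 0^'] --> c s 0 j.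
    case: (j < i)%N; last exact: cvg_cst.
    have : a j h + c s 0 j @[h --> 0^'] --> 0 + c s 0 j.
      by apply: rcvgD => //; exact: cvg_cst.
    by rewrite add0r; under eq_cvg do rewrite /a subrK.
  have xj : xi (i, h) * ((0 == 0 :> 'I_1) && (j == i))%:R @[h --> 0^'] -->
      (0 : R) * ((0 == 0 :> 'I_1) && (j == i))%:R.
    by apply: rcvgM => //; exact: cvg_cst.
  have := rcvgD xj qj; rewrite mul0r add0r; exact.
have acvg' (i : 'I_n) : h^-1 * a i h @[h --> 0^'] --> 'D_1 (fun h => c h 0 i) s.
  have := dci i; rewrite /derivable => /cvg_ex[l hl].
  have -> : 'D_1 (fun h => c h 0 i) s = l by apply/cvg_lim.
  by move: hl; under eq_cvg do rewrite /= [_ *: 1]mulr1.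
have lim : h^-1 *: (F (c (h *: (1:R) + s)) - F (c s)) @[h --> 0^'] -->
    (\sum_i 'D_(delta_mx 0 i) F (c s) * 'D_1 (fun h => c h 0 i) s).
  under eq_cvg do rewrite /= [_ *: 1]mulr1 tele scaler_sumr.
  apply: cvg_big => [|i _]; first exact: add_continuous.
  (* Each telescoped term is a partial derivative at a point tending to [c s], times the difference
     quotient of one coordinate of [c]. *)
  have -> : (fun h => h^-1 *: (F (q i.+1 h) - F (q i h))) = (fun h =>
    'D_(delta_mx 0 i) F (xi (i, h) *: delta_mx 0 i + q i h) * (h^-1 * a i h)).
    apply/funext => h; have [_ ->] := xiP (i, h).
    by rewrite [_ *: _]mulrCA.
  have Fq := cvg_comp _ _ (qcvg i) (cF i (c s)).
  exact: rcvgM Fq (acvg' i).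
by apply: DeriveDef; [apply: cvgP lim|apply/cvg_lim].
Unshelve. all: by end_near. Qed.

(** * Functions of class C^k *)

Lemma derive_lineE (R : realType) (V : normedModType R) (f : V -> R) (x v : V) :
  'D_v f x = 'D_1 (fun h : R => f (h *: v + x)) 0.
Proof.
rewrite /derive; set g1 := fun h => h^-1 *: _; set g2 := fun h => h^-1 *: _.
suff -> : g1 = g2 by [].
by rewrite funeqE /g1 /g2 => h /=; rewrite addr0 scale0r add0r [h *: 1]mulr1.
Qed.

(** A directional derivative only sees the curve [Phi (h *: v + p)], so the chain rule along a curve
    applies. *)
Lemma is_derive_comp_rV (R : realType) (V : normedModType R) n (F : 'rV[R]_n -> R)
    (Phi : V -> 'rV[R]_n) (p v : V) :
  (forall i q, derivable F q (delta_mx 0 i)) ->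
  (forall i, continuous ('D_(delta_mx 0 i) F)) ->
  (forall i, derivable (fun q => Phi q 0 i) p v) ->
  is_derive p v (fun q => F (Phi q))
    (\sum_i 'D_(delta_mx 0 i) F (Phi p) * 'D_v (fun q => Phi q 0 i) p).
Proof.
move=> dF cF dPhi; pose c (h : R) := Phi (h *: v + p).
have dc : derivable c 0 1.
  apply/derivable_mxP => i j; rewrite (ord1 i).
  exact: (proj1 (derivable1P _ _ _) (dPhi j)).
have [d1 d2] := is_derive_curve dF cF dc.
apply: DeriveDef; first by apply/derivable1P; exact: d1.
rewrite derive_lineE d2 /c scale0r add0r.
by apply: eq_bigr => i _; rewrite (derive_lineE (fun q => Phi q 0 i)).
Qed.

Lemma is_derive_coord (R : realType) n (j : 'I_n) (p v : 'rV[R]_n) :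
  is_derive p v (fun q : 'rV[R]_n => q 0 j) (v 0 j).
Proof.
have did : derivable (@id 'rV[R]_n) p v by apply: derivable_id.
apply: DeriveDef; first exact: (proj1 (derivable_mxP _ _ _) did 0 j).
have := derive_mx did; rewrite derive_id => /(congr1 (fun M : 'rV[R]_n => M 0 j)).
by rewrite mxE => ->.
Qed.

Section Ck.
Variable R : realType.

Lemma Ck_continuous n k (F : 'rV[R]_n -> R) : Ck k F -> continuous F.
Proof. by case: k => [//|k []]. Qed.

Lemma CkW n k (F : 'rV[R]_n -> R) : Ck k.+1 F -> Ck k F.
Proof.
elim: k F => [F []//|k IH F [cF dF DF]].
by split=> // i; apply: IH; exact: DF.
Qed.

Lemma Ck_cst n k (c : R) : Ck k (fun _ : 'rV[R]_n => c).
Proof.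
elim: k c => [c|k IH c]; first exact: cst_continuous.
split=> [|i p|i]; [exact: cst_continuous|exact: derivable_cst|].
rewrite (_ : 'D__ _ = (fun=> 0)); first exact: IH.
by apply/funext => p; rewrite derive_cst.
Qed.

Lemma Ck_coord n k (j : 'I_n) : Ck k (fun p : 'rV[R]_n => p 0 j).
Proof.
case: k => [|k]; first exact: coord_continuous.
split=> [|i p|i]; first exact: coord_continuous.
  by have [] := is_derive_coord j p (delta_mx 0 i).
rewrite (_ : 'D__ _ = (fun=> (delta_mx 0 i : 'rV[R]_n) 0 j)); first exact: Ck_cst.
by apply/funext => p; have [_ ->] := is_derive_coord j p (delta_mx 0 i).
Qed.

Lemma Ck_add n k (F G : 'rV[R]_n -> R) :
  Ck k F -> Ck k G -> Ck k (fun p => F p + G p).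
Proof.
elim: k F G => [F G cF cG p|k IH F G [cF dF DF] [cG dG DG]].
  exact: (rcvgD (cF p) (cG p)).
split=> [p|i p|i]; first exact: (rcvgD (cF p) (cG p)).
  exact: derivableD.
rewrite (_ : 'D__ _ = (fun p => 'D_(delta_mx 0 i) F p + 'D_(delta_mx 0 i) G p)).
  by apply: IH; [exact: DF|exact: DG].
by apply/funext => p; apply: deriveD.
Qed.

Lemma Ck_mul n k (F G : 'rV[R]_n -> R) :
  Ck k F -> Ck k G -> Ck k (fun p => F p * G p).
Proof.
elim: k F G => [F G cF cG p|k IH F G CF CG].
  exact: (rcvgM (cF p) (cG p)).
have [cF dF DF] := CF; have [cG dG DG] := CG.
split=> [p|i p|i]; first exact: (rcvgM (cF p) (cG p)).
  exact: derivableM.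
rewrite (_ : 'D__ _ = (fun p => F p * 'D_(delta_mx 0 i) G p +
                                G p * 'D_(delta_mx 0 i) F p)).
  by apply: Ck_add; apply: IH; by [exact: CkW CF|exact: CkW CG|exact: DF|exact: DG].
by apply/funext => p; apply: deriveM.
Qed.

Lemma Ck_sum n k m (F : 'I_m -> 'rV[R]_n -> R) :
  (forall i, Ck k (F i)) -> Ck k (fun p => \sum_i F i p).
Proof.
move=> CF; rewrite (_ : (fun p => _) = \sum_i F i); last first.
  by apply/funext => p; rewrite fct_sumE.
apply: (big_ind (@Ck R n k)) => //; first exact: Ck_cst.
by move=> f g; exact: Ck_add.
Qed.

(** The chain rule writes a partial derivative of the composite as a sum of products of functions of
    class one lower, to which the induction hypothesis applies. *)
Lemma Ck_comp n m k (F : 'rV[R]_n -> R) (Phi : 'rV[R]_m -> 'rV[R]_n) :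
  Ck k F -> (forall j, Ck k (fun p => Phi p 0 j)) -> Ck k (fun p => F (Phi p)).
Proof.
have comp_cont (G : 'rV[R]_n -> R) (Psi : 'rV[R]_m -> 'rV[R]_n) :
    continuous G -> (forall j, continuous (fun p => Psi p 0 j)) ->
    continuous (fun p => G (Psi p)).
  move=> cG cP p.
  have cPp : Psi q @[q --> p] --> Psi p by apply: (rV_cvgP (nbhs_filter p)) => j; exact: cP.
  exact: (cvg_comp _ _ cPp (cG (Psi p))).
elim: k F Phi => [F Phi|k IH F Phi CF CP]; first exact: comp_cont.
have [cF dF DF] := CF.
have cDF i : continuous ('D_(delta_mx 0 i) F) by exact: Ck_continuous (DF i).
have D p i := is_derive_comp_rV dF cDF
  (fun j => let: And3 _ dP _ := CP j in dP i p).
split=> [|i p|i].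
- exact: (comp_cont _ _ cF (fun j => Ck_continuous (CP j))).
- by have [] := D p i.
- rewrite (_ : 'D__ _ = (fun p => \sum_j 'D_(delta_mx 0 j) F (Phi p) *
      'D_(delta_mx 0 i) (fun q => Phi q 0 j) p)).
    apply: Ck_sum => j; apply: Ck_mul.
      exact: (IH _ Phi (DF j) (fun l => CkW (CP l))).
    by have [_ _] := CP j; exact.
  by apply/funext => p; have [_ ->] := D p i.
Qed.

End Ck.

(** The second difference [G] over a square of side [h] is symmetric in the two directions. The mean
    value theorem, used once in each direction, makes it [h * h] times a mixed derivative at a point
    tending to [p], and both mixed derivatives are continuous. *)
Lemma derive_swap (R : realType) n (F : 'rV[R]_n -> R) (i j : 'I_n) :
  Ck 2 F ->
  'D_(delta_mx 0 j) ('D_(delta_mx 0 i) F) = 'D_(delta_mx 0 i) ('D_(delta_mx 0 j) F).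
Proof.
move=> [_ dF DF]; apply/funext => p.
pose e (k : 'I_n) : 'rV[R]_n := delta_mx 0 k.
pose G (k l : 'I_n) (h : R) :=
  F (h *: e k + (h *: e l + p)) - F (h *: e k + p) - (F (h *: e l + p) - F p).
have inc k l h : exists st : R * R, [/\ `|st.1| <= `|h|, `|st.2| <= `|h| &
    G k l h = 'D_(e k) ('D_(e l) F) (st.1 *: e k + (st.2 *: e l + p)) * h * h].
  (* The increment along [e k] is treated as a function of the base point: the mean value theorem
     along [e l] is applied to [g], then the one along [e k] to the derivative of [F] along
     [e l]. *)
  pose g q := F (h *: e k + q) - F q.
  have dFs q : is_derive q (e l) (fun q => F (h *: e k + q))
      ('D_(e l) F (h *: e k + q)).
    rewrite (_ : (fun q => _) = F \o shift (h *: e k)); last first.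
      by apply/funext => x; rewrite /= addrC.
    have E : (fun t : R => t^-1 *: ((F \o shift (h *: e k)) (t *: e l + q) -
        (F \o shift (h *: e k)) q)) =
      (fun t => t^-1 *: (F (t *: e l + (h *: e k + q)) - F (h *: e k + q))).
      by apply/funext => t /=; rewrite -addrA [q + _]addrC.
    by apply: DeriveDef; rewrite /derivable /derive /= E; [exact: dF|].
  have dg q : derivable g q (e l).
    by apply: derivableB; [have [] := dFs q|exact: dF].
  have [t t1 t2] := MVT_line p h dg.
  have [_ dDF _] := DF l.
  have [s s1 s2] := MVT_line (t *: e l + p) h (dDF k).
  exists (s, t); split=> //=; rewrite -s2 /G.
  rewrite -[F (h *: e k + (h *: e l + p)) - _ - _]addrAC.
  have -> : F (h *: e k + (h *: e l + p)) - (F (h *: e l + p) - F p) - F (h *: e k + p) =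
     g (h *: e l + p) - g p by rewrite /g; ring.
  rewrite t2; congr (_ * _).
  rewrite deriveB; [|by have [] := dFs (t *: e l + p)|exact: dF].
  by have [_ ->] := dFs (t *: e l + p).
have lim0 (s : R -> R) : (forall h, `|s h| <= `|h|) -> s h @[h --> 0^'] --> 0.
  move=> sh.
  have n0 : `|h| @[h --> (0 : R)^'] --> 0.
    have : `|h| @[h --> (0 : R)^'] --> `|0 : R|.
      by apply: cvg_norm; apply: cvg_within_filter; exact: cvg_id.
    by rewrite normr0.
  have n1 : - `|h| @[h --> (0 : R)^'] --> 0.
    have : - `|h| @[h --> (0 : R)^'] --> - (0 : R) by apply: cvgN.
    by rewrite oppr0.
  apply: (@squeeze_cvgr _ _ _ _ (fun h => - `|h|) (fun h => `|h|)) => //.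
  by near=> h; rewrite -ler_norml.
have limD k l : exists2 D : R -> R,
    D h @[h --> 0^'] --> 'D_(e k) ('D_(e l) F) p & forall h, G k l h = D h * h * h.
  have [st stP] := choice (inc k l).
  exists (fun h => 'D_(e k) ('D_(e l) F) ((st h).1 *: e k + ((st h).2 *: e l + p))).
    have c1 : (st h).1 *: e k + ((st h).2 *: e l + p) @[h --> 0^'] --> p.
      have z1 : (st h).1 *: e k @[h --> 0^'] --> 0 *: e k.
        by apply: cvgZr_tmp; apply: lim0 => h; have [] := stP h.
      have z2 : (st h).2 *: e l @[h --> 0^'] --> 0 *: e l.
        by apply: cvgZr_tmp; apply: lim0 => h; have [] := stP h.
      by have := cvgD z1 (cvgD z2 (cvg_cst p)); rewrite !scale0r !add0r; exact.
    have [_ _ /(_ k) /= cDF] := DF l.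
    exact: (cvg_comp _ _ c1 (cDF p)).
  by move=> h; have [] := stP h.
have [D1 c1 E1] := limD j i; have [D2 c2 E2] := limD i j.
have G_sym h : G i j h = G j i h.
  have sw (a b c d : R) : a - b - (c - d) = a - c - (b - d) by ring.
  by rewrite /G [h *: e i + (_ + _)]addrCA; exact: sw.
have D12 : {near 0^', D1 =1 D2}.
  near=> h; have h0 : h != 0 by near: h; exact: nbhs_dnbhs_neq.
  by apply/(mulIf h0)/(mulIf h0); rewrite -E1 -E2.
have c2' : D1 h @[h --> 0^'] --> 'D_(e i) ('D_(e j) F) p.
  by apply: cvg_trans c2; apply: near_eq_cvg; near do apply: esym.
rewrite -/(e i) -/(e j) -(cvg_lim (@norm_hausdorff R _) c1).
exact: (cvg_lim (@norm_hausdorff R _) c2').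
Unshelve. all: by end_near. Qed.

(** * Partial derivatives of smooth functions *)

Section RealDerivatives.
Variable R : realType.
Implicit Types (f g : R -> R) (x a b : R).

Lemma is_derive_add f g x a b : is_derive x (1 : R) f a -> is_derive x (1 : R) g b ->
  is_derive x (1 : R) (fun y => f y + g y) (a + b).
Proof. move=> df dg; exact: is_deriveD. Qed.

Lemma is_derive_sub f g x a b : is_derive x (1 : R) f a -> is_derive x (1 : R) g b ->
  is_derive x (1 : R) (fun y => f y - g y) (a - b).
Proof. move=> df dg; exact: is_deriveB. Qed.

Lemma is_derive_opp f x a : is_derive x (1 : R) f a ->
  is_derive x (1 : R) (fun y => - f y) (- a).
Proof. move=> df; exact: is_deriveN. Qed.

Lemma is_derive_mul f g x a b : is_derive x (1 : R) f a -> is_derive x (1 : R) g b ->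
  is_derive x (1 : R) (fun y => f y * g y) (a * g x + f x * b).
Proof.
move=> df dg; apply: (is_derive_eq (is_deriveM df dg)).
by rewrite addrC [_ *: a]mulrC.
Qed.

Lemma is_derive_const x a : is_derive x (1 : R) (fun _ : R => a) 0.
Proof. exact: is_derive_cst. Qed.

Lemma is_derive_self x : is_derive x (1 : R) (fun y : R => y) 1.
Proof. exact: is_derive_id. Qed.

Lemma derive1_eq f x a : is_derive x (1 : R) f a -> derive1 f x = a.
Proof. by move=> [_ <-]; rewrite derive1E. Qed.

End RealDerivatives.

(* is_derive is a type class: without notypeclasses each step would first run the
   instances of the library. *)
Ltac is_derive_rules :=
  lazymatch goal with
  | H : is_derive ?x _ ?f _ |- is_derive ?x _ ?f _ => exact: H
  | |- is_derive _ _ (fun _ => ?c) _ => exact: is_derive_const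
  | |- is_derive _ _ (fun y => y) _ => exact: is_derive_self
  | |- is_derive ?x _ ( *%R ?c) _ =>
      notypeclasses refine (is_derive_mul (is_derive_const x c) (is_derive_self x))
  | |- is_derive _ _ (fun y => @?f y + (- @?g y)) _ =>
      notypeclasses refine (is_derive_sub _ _); cbv beta; is_derive_rules
  | |- is_derive _ _ (fun y => @?f y + @?g y) _ =>
      notypeclasses refine (is_derive_add _ _); cbv beta; is_derive_rules
  | |- is_derive _ _ (fun y => - @?f y) _ =>
      notypeclasses refine (is_derive_opp _); cbv beta; is_derive_rules
  | |- is_derive _ _ (fun y => @?f y * @?g y) _ =>
      notypeclasses refine (is_derive_mul _ _); cbv beta; is_derive_rules
  | |- _ => idtac
  end.

Ltac derive_by := notypeclasses refine (is_derive_eq _ _);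
  [is_derive_rules | cbv beta].

Section Smooth.
Variable R : realType.
Implicit Types (u : R -> R -> R) (f : R -> R -> R -> R -> R).

Lemma smoothn_cst n (c : R) : smoothn (fun _ : 'rV[R]_n => c).
Proof. by move=> k; exact: Ck_cst. Qed.

Lemma smoothn_cmp n i : smoothn (fun p : 'rV[R]_n.+1 => cmp p i).
Proof. by move=> k; exact: Ck_coord. Qed.

Lemma smoothn_add n (F G : 'rV[R]_n -> R) :
  smoothn F -> smoothn G -> smoothn (fun p => F p + G p).
Proof. by move=> sF sG k; exact: Ck_add. Qed.

Lemma smoothn_mul n (F G : 'rV[R]_n -> R) :
  smoothn F -> smoothn G -> smoothn (fun p => F p * G p).
Proof. by move=> sF sG k; exact: Ck_mul. Qed.

Lemma smoothn_opp n (F : 'rV[R]_n -> R) : smoothn F -> smoothn (fun p => - F p).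
Proof.
move=> sF; rewrite (_ : (fun p => _) = fun p => -1 * F p); last first.
  by apply/funext => p; rewrite mulN1r.
by apply: smoothn_mul => //; exact: smoothn_cst.
Qed.

Lemma smoothn_derive n (F : 'rV[R]_n -> R) i :
  smoothn F -> smoothn ('D_(delta_mx 0 i) F).
Proof. by move=> sF k; have [_ _] := sF k.+1; exact. Qed.

(** Coordinates come as a sequence, padded by 0, so that [smoothn_pt] serves functions of one, two
    and four variables alike. *)
Definition pt n (s : seq R) : 'rV[R]_n.+1 := \row_j nth 0 s j.

Lemma cmp_pt n s i : (i <= n)%N -> cmp (pt n s) i = nth 0 s i.
Proof. by move=> ?; rewrite /cmp mxE inordK. Qed.

Lemma cmp_line n (h : R) i j (p : 'rV[R]_n.+1) : (i <= n)%N -> (j <= n)%N ->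
  cmp (h *: delta_mx 0 (inord j) + p) i = if i == j then h + cmp p i else cmp p i.
Proof.
move=> ilen jlen; rewrite /cmp !mxE eqxx /=.
rewrite -(inj_eq val_inj) /= !inordK //.
by case: eqP => _; rewrite ?mulr1 ?mulr0 ?add0r.
Qed.

Lemma smoothn_pt n m (F : 'rV[R]_n.+1 -> R) (s : 'rV[R]_m -> seq R) :
  smoothn F -> (forall i, smoothn (fun p => nth 0 (s p) i)) ->
  smoothn (fun p => F (pt n (s p))).
Proof.
move=> sF ss k; apply: Ck_comp (sF k) _ => j.
rewrite (_ : (fun p => _) = fun p => nth 0 (s p) j); first exact: ss.
by apply/funext => p; rewrite mxE.
Qed.

Definition d1 f t x a b := derive1 (fun s => f s x a b) t.
Definition d2 f t x a b := derive1 (fun s => f t s a b) x.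
Definition d3 f t x a b := derive1 (fun s => f t x s b) a.
Definition d4 f t x a b := derive1 (fun s => f t x a s) b.

(* The functions of row vectors to which smooth2 and smooth4 refer. *)
Definition fun2 (u : R -> R -> R) (p : 'rV[R]_2) := u (cmp p 0) (cmp p 1).
Definition fun4 (f : R -> R -> R -> R -> R) (p : 'rV[R]_4) :=
  f (cmp p 0) (cmp p 1) (cmp p 2) (cmp p 3).

(** Both sides apply the limit operator to the same difference quotient. The identities below are
    thus equalities of functions, usable for rewriting under further derivatives. *)
Lemma derive_slice n (F : 'rV[R]_n.+1 -> R) (f : R -> R) i p t :
  (forall h : R, F (h *: delta_mx 0 (inord i) + p) = f (h + t)) ->
  'D_(delta_mx 0 (inord i)) F p = derive1 f t.
Proof.
move=> E; rewrite /derive /derive1.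
set g1 := fun h => h^-1 *: _; set g2 := fun h => h^-1 *: _.
suff -> : g1 = g2 by [].
have E0 := E 0; rewrite scale0r !add0r in E0.
by rewrite funeqE /g1 /g2 => h /=; rewrite E E0.
Qed.

Lemma derive_fun2_0 u : 'D_(delta_mx 0 (inord 0)) (fun2 u) = fun2 (dt u).
Proof. by apply/funext => p; apply: derive_slice => h; rewrite /fun2 /fun4 !cmp_line. Qed.
Lemma derive_fun2_1 u : 'D_(delta_mx 0 (inord 1)) (fun2 u) = fun2 (dx u).
Proof. by apply/funext => p; apply: derive_slice => h; rewrite /fun2 /fun4 !cmp_line. Qed.
Lemma derive_fun4_0 f : 'D_(delta_mx 0 (inord 0)) (fun4 f) = fun4 (d1 f).
Proof. by apply/funext => p; apply: derive_slice => h; rewrite /fun2 /fun4 !cmp_line. Qed.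
Lemma derive_fun4_1 f : 'D_(delta_mx 0 (inord 1)) (fun4 f) = fun4 (d2 f).
Proof. by apply/funext => p; apply: derive_slice => h; rewrite /fun2 /fun4 !cmp_line. Qed.
Lemma derive_fun4_2 f : 'D_(delta_mx 0 (inord 2)) (fun4 f) = fun4 (d3 f).
Proof. by apply/funext => p; apply: derive_slice => h; rewrite /fun2 /fun4 !cmp_line. Qed.
Lemma derive_fun4_3 f : 'D_(delta_mx 0 (inord 3)) (fun4 f) = fun4 (d4 f).
Proof. by apply/funext => p; apply: derive_slice => h; rewrite /fun2 /fun4 !cmp_line. Qed.

Lemma smooth2_dt u : smooth2 u -> smooth2 (dt u).
Proof. by move=> su; have := smoothn_derive (inord 0) su; rewrite derive_fun2_0. Qed.
Lemma smooth2_dx u : smooth2 u -> smooth2 (dx u).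
Proof. by move=> su; have := smoothn_derive (inord 1) su; rewrite derive_fun2_1. Qed.
Lemma smooth4_d1 f : smooth4 f -> smooth4 (d1 f).
Proof. by move=> sf; have := smoothn_derive (inord 0) sf; rewrite derive_fun4_0. Qed.
Lemma smooth4_d2 f : smooth4 f -> smooth4 (d2 f).
Proof. by move=> sf; have := smoothn_derive (inord 1) sf; rewrite derive_fun4_1. Qed.
Lemma smooth4_d3 f : smooth4 f -> smooth4 (d3 f).
Proof. by move=> sf; have := smoothn_derive (inord 2) sf; rewrite derive_fun4_2. Qed.
Lemma smooth4_d4 f : smooth4 f -> smooth4 (d4 f).
Proof. by move=> sf; have := smoothn_derive (inord 3) sf; rewrite derive_fun4_3. Qed.

Lemma derivable_slice n (F : 'rV[R]_n.+1 -> R) (f : R -> R) i p t :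
  smoothn F -> (forall h : R, F (h *: delta_mx 0 (inord i) + p) = f (h + t)) ->
  is_derive t (1 : R) f (derive1 f t).
Proof.
move=> sF E; have [_ /(_ (inord i) p) + _] := sF 1%N.
rewrite /derivable; set g1 := fun h => h^-1 *: _ => dF.
apply: DeriveDef; last by rewrite derive1E.
rewrite /derivable; set g2 := fun h => h^-1 *: _.
suff -> : g2 = g1 by [].
have E0 := E 0; rewrite scale0r !add0r in E0.
by rewrite funeqE /g1 /g2 => h /=; rewrite [_ *: 1]mulr1 E E0.
Qed.

Ltac slice i p :=
  let H := fresh in intro H; refine (@derivable_slice _ _ _ i p _ H _);
  let h := fresh in intro h; by rewrite !cmp_line // !cmp_pt.

Lemma is_derive_dt u t x : smooth2 u -> is_derive t (1 : R) (fun s => u s x) (dt u t x).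
Proof. slice 0%N (pt 1 [:: t; x]). Qed.
Lemma is_derive_dx u t x : smooth2 u -> is_derive x (1 : R) (fun y => u t y) (dx u t x).
Proof. slice 1%N (pt 1 [:: t; x]). Qed.
Lemma is_derive_d2 f t x a b : smooth4 f ->
  is_derive x (1 : R) (fun s => f t s a b) (d2 f t x a b).
Proof. slice 1%N (pt 3 [:: t; x; a; b]). Qed.
Lemma is_derive_d3 f t x a b : smooth4 f ->
  is_derive a (1 : R) (fun s => f t x s b) (d3 f t x a b).
Proof. slice 2%N (pt 3 [:: t; x; a; b]). Qed.
Lemma is_derive_d4 f t x a b : smooth4 f ->
  is_derive b (1 : R) (fun s => f t x a s) (d4 f t x a b).
Proof. slice 3%N (pt 3 [:: t; x; a; b]). Qed.

Lemma dt_dx u : smooth2 u -> dt (dx u) = dx (dt u).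
Proof.
move=> su.
have E : fun2 (dt (dx u)) = fun2 (dx (dt u)).
  pose D k (F : 'rV[R]_2 -> R) := 'D_(delta_mx 0 (inord k)) F.
  exact: (etrans (esym (derive_fun2_0 (dx u)))
    (etrans (congr1 (D 0%N) (esym (derive_fun2_1 u)))
    (etrans (@derive_swap _ _ (fun2 u) (inord 1) (inord 0) (su 2%N))
    (etrans (congr1 (D 1%N) (derive_fun2_0 u)) (derive_fun2_1 (dt u)))))).
apply/funext => t; apply/funext => x.
by have := congr1 (fun F => F (pt 1 [:: t; x])) E; rewrite /fun2 !cmp_pt.
Qed.

Lemma d2_d3 f : smooth4 f -> d2 (d3 f) = d3 (d2 f).
Proof.
move=> sf.
have E : fun4 (d2 (d3 f)) = fun4 (d3 (d2 f)).
  pose D k (F : 'rV[R]_4 -> R) := 'D_(delta_mx 0 (inord k)) F.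
  exact: (etrans (esym (derive_fun4_1 (d3 f)))
    (etrans (congr1 (D 1%N) (esym (derive_fun4_2 f)))
    (etrans (@derive_swap _ _ (fun4 f) (inord 2) (inord 1) (sf 2%N))
    (etrans (congr1 (D 2%N) (derive_fun4_1 f)) (derive_fun4_2 (d2 f)))))).
apply/funext => t; apply/funext => x; apply/funext => a; apply/funext => b.
by have := congr1 (fun F => F (pt 3 [:: t; x; a; b])) E; rewrite /fun4 !cmp_pt.
Qed.

End Smooth.

(** * Prolongations *)

Section Composition.
Variable R : realType.
Implicit Types (u v : R -> R -> R) (f : R -> R -> R -> R -> R).

Lemma smoothn_sub n (F G : 'rV[R]_n -> R) :
  smoothn F -> smoothn G -> smoothn (fun p => F p - G p).
Proof. by move=> sF sG; apply: smoothn_add => //; exact: smoothn_opp. Qed.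

Lemma smoothn_sqr n (F : 'rV[R]_n -> R) : smoothn F -> smoothn (fun p => F p ^+ 2).
Proof. by move=> sF; apply: (smoothn_mul sF sF). Qed.

Lemma smoothn_app1 n (g : R -> R) (F : 'rV[R]_n -> R) :
  smooth1 g -> smoothn F -> smoothn (fun p => g (F p)).
Proof.
move=> sg sF.
have := smoothn_pt (s := fun p => [:: F p]) sg.
under [fun p => _]eq_fun do rewrite cmp_pt //=.
(* Past the end of the sequence [nth] is the default 0, a constant. *)
by apply=> -[|i] //=; rewrite ?nth_nil; exact: smoothn_cst.
Qed.

Lemma smoothn_app2 n u (F G : 'rV[R]_n -> R) :
  smooth2 u -> smoothn F -> smoothn G -> smoothn (fun p => u (F p) (G p)).
Proof.
move=> su sF sG.
have := smoothn_pt (s := fun p => [:: F p; G p]) su.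
under [fun p => _]eq_fun do rewrite !cmp_pt //=.
by apply=> -[|[|i]] //=; rewrite ?nth_nil; exact: smoothn_cst.
Qed.

Lemma smoothn_app4 n f (F G H K : 'rV[R]_n -> R) :
  smooth4 f -> smoothn F -> smoothn G -> smoothn H -> smoothn K ->
  smoothn (fun p => f (F p) (G p) (H p) (K p)).
Proof.
move=> sf sF sG sH sK.
have := smoothn_pt (s := fun p => [:: F p; G p; H p; K p]) sf.
under [fun p => _]eq_fun do rewrite !cmp_pt //=.
by apply=> -[|[|[|[|i]]]] //=; rewrite ?nth_nil; exact: smoothn_cst.
Qed.

End Composition.

(** The arithmetic cases precede those for an arbitrary [?g], since a sum or a product also matches
    as a function of two arguments. *)
Ltac smooth_rules :=
  lazymatch goal with
  | |- smoothn (fun _ => ?c) => exact: smoothn_cst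
  | |- smoothn (fun p => cmp p _) => exact: smoothn_cmp
  | |- smoothn (fun p => @?F p - @?G p) => refine (smoothn_sub _ _); cbv beta; smooth_rules
  | |- smoothn (fun p => @?F p + @?G p) => refine (smoothn_add _ _); cbv beta; smooth_rules
  | |- smoothn (fun p => - @?F p) => refine (smoothn_opp _); cbv beta; smooth_rules
  | |- smoothn (fun p => @?F p * @?G p) => refine (smoothn_mul _ _); cbv beta; smooth_rules
  | |- smoothn (fun p => @?F p ^+ 2) => refine (smoothn_sqr _); cbv beta; smooth_rules
  | |- smoothn (fun p => ?g (@?F p) (@?G p) (@?H p) (@?K p)) =>
      refine (@smoothn_app4 _ _ g F G H K _ _ _ _ _); cbv beta; smooth_rules
  | |- smoothn (fun p => ?g (@?F p) (@?G p)) =>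
      refine (@smoothn_app2 _ _ g F G _ _ _); cbv beta; smooth_rules
  | |- smoothn (fun p => ?g (@?F p)) =>
      refine (@smoothn_app1 _ _ g F _ _); cbv beta; smooth_rules
  | H : smooth4 ?f |- smooth4 ?f => exact: H
  | H : smooth2 ?f |- smooth2 ?f => exact: H
  | H : smooth1 ?f |- smooth1 ?f => exact: H
  | |- smooth2 (dt _) => apply: smooth2_dt; smooth_rules
  | |- smooth2 (dx _) => apply: smooth2_dx; smooth_rules
  | |- smooth4 (d1 _) => apply: smooth4_d1; smooth_rules
  | |- smooth4 (d2 _) => apply: smooth4_d2; smooth_rules
  | |- smooth4 (d3 _) => apply: smooth4_d3; smooth_rules
  | |- smooth4 (d4 _) => apply: smooth4_d4; smooth_rules
  | |- smooth1 _ => rewrite /smooth1; cbv beta; smooth_rules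
  | |- smooth2 _ => rewrite /smooth2; cbv beta; smooth_rules
  | |- smooth4 _ => rewrite /smooth4; cbv beta; smooth_rules
  | |- _ => idtac
  end.

(* ring and lra compare atoms up to conversion, which would unfold the limits. *)
Ltac gen_atoms := repeat match goal with
  | |- context [dx ?f ?t ?x] => generalize (dx f t x); intro
  | |- context [dt ?f ?t ?x] => generalize (dt f t x); intro
  | |- context [d1 ?f ?t ?x ?a ?b] => generalize (d1 f t x a b); intro
  | |- context [d2 ?f ?t ?x ?a ?b] => generalize (d2 f t x a b); intro
  | |- context [d3 ?f ?t ?x ?a ?b] => generalize (d3 f t x a b); intro
  | |- context [d4 ?f ?t ?x ?a ?b] => generalize (d4 f t x a b); intro
  | |- context [derive1 ?f ?t] => generalize (derive1 f t); intro
  end.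

Section Prolongation.
Variable R : realType.
Implicit Types (u v : R -> R -> R) (f : R -> R -> R -> R -> R).

Lemma dtE u t x a : is_derive t (1 : R) (fun s => u s x) a -> dt u t x = a.
Proof. exact: derive1_eq. Qed.

Lemma dxE u t x a : is_derive x (1 : R) (fun y => u t y) a -> dx u t x = a.
Proof. exact: derive1_eq. Qed.

Lemma is_derive_app4 f (a b c d : R -> R) (s a' b' c' d' : R) : smooth4 f ->
  is_derive s (1 : R) a a' -> is_derive s (1 : R) b b' ->
  is_derive s (1 : R) c c' -> is_derive s (1 : R) d d' ->
  is_derive s (1 : R) (fun h => f (a h) (b h) (c h) (d h))
    (d1 f (a s) (b s) (c s) (d s) * a' + d2 f (a s) (b s) (c s) (d s) * b' +
     d3 f (a s) (b s) (c s) (d s) * c' + d4 f (a s) (b s) (c s) (d s) * d').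
Proof.
move=> sf da db dc dd; pose c4 h := pt 3 [:: a h; b h; c h; d h].
have dcmp (i : 'I_4) : is_derive s (1 : R) (fun h => c4 h 0 i) (nth 0 [:: a'; b'; c'; d'] i).
  rewrite (_ : (fun h => _) = fun h => nth 0 [:: a h; b h; c h; d h] i); last first.
    by apply/funext => h; rewrite mxE.
  by case: i => -[|[|[|[|i]]]].
have dc4 : derivable c4 s 1.
  by apply/derivable_mxP => i j; rewrite (ord1 i); have [] := dcmp j.
have dF i p : derivable (fun4 f) p (delta_mx 0 i).
  by have [_ dF _] := sf 1%N; exact: dF.
have cF i : continuous ('D_(delta_mx 0 i) (fun4 f)).
  exact: Ck_continuous (smoothn_derive i sf 0%N).
rewrite (_ : (fun h => _) = fun h => fun4 f (c4 h)); last first.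
  by apply/funext => h; rewrite /fun4 !cmp_pt.
apply: (is_derive_eq (@is_derive_curve _ _ (fun4 f) _ _ dF cF dc4)).
have cs g : fun4 g (c4 s) = g (a s) (b s) (c s) (d s) by rewrite /fun4 !cmp_pt.
have hD k : (k < 4)%N -> 'D_(delta_mx 0 (inord k)) (fun4 f) (c4 s) =
    nth 0 [:: d1 f (a s) (b s) (c s) (d s); d2 f (a s) (b s) (c s) (d s);
              d3 f (a s) (b s) (c s) (d s); d4 f (a s) (b s) (c s) (d s)] k.
  case: k => [|[|[|[|//]]]] _.
  - exact: (etrans (congr1 (fun F => F (c4 s)) (derive_fun4_0 f)) (cs (d1 f))).
  - exact: (etrans (congr1 (fun F => F (c4 s)) (derive_fun4_1 f)) (cs (d2 f))).
  - exact: (etrans (congr1 (fun F => F (c4 s)) (derive_fun4_2 f)) (cs (d3 f))).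
  - exact: (etrans (congr1 (fun F => F (c4 s)) (derive_fun4_3 f)) (cs (d4 f))).
transitivity (\sum_(i < 4) nth 0 [:: d1 f (a s) (b s) (c s) (d s);
   d2 f (a s) (b s) (c s) (d s); d3 f (a s) (b s) (c s) (d s);
   d4 f (a s) (b s) (c s) (d s)] i * nth 0 [:: a'; b'; c'; d'] i).
  apply: eq_bigr => i _; rewrite (@derive_val _ _ _ _ _ _ _ (dcmp i)).
  by rewrite -[in delta_mx _ i](inord_val i) (hD i (ltn_ord i)).
by rewrite !big_ord_recl big_ord0 /= addr0 !addrA.
Qed.

(** This is [f] restricted to the graph of [(u, v)]; its [dt] and [dx] are the total derivatives of
    [f]. *)
Definition jet_comp f u v : R -> R -> R := fun t x => f t x (u t x) (v t x).

Lemma smooth2_jet_comp f u v :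
  smooth4 f -> smooth2 u -> smooth2 v -> smooth2 (jet_comp f u v).
Proof. by move=> sf su sv; rewrite /jet_comp; smooth_rules. Qed.

Lemma dt_jet_comp f u v : smooth4 f -> smooth2 u -> smooth2 v ->
  dt (jet_comp f u v) = fun t x => jet_comp (d1 f) u v t x +
    jet_comp (d3 f) u v t x * dt u t x + jet_comp (d4 f) u v t x * dt v t x.
Proof.
move=> sf su sv; apply/funext => t; apply/funext => x; notypeclasses refine (dtE _).
apply: (is_derive_eq (is_derive_app4 sf (is_derive_self t) (is_derive_const t x)
  (is_derive_dt t x su) (is_derive_dt t x sv))).
by rewrite mulr1 mulr0 addr0 /jet_comp.
Qed.

Lemma dx_jet_comp f u v : smooth4 f -> smooth2 u -> smooth2 v ->
  dx (jet_comp f u v) = fun t x => jet_comp (d2 f) u v t x +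
    jet_comp (d3 f) u v t x * dx u t x + jet_comp (d4 f) u v t x * dx v t x.
Proof.
move=> sf su sv; apply/funext => t; apply/funext => x; notypeclasses refine (dxE _).
apply: (is_derive_eq (is_derive_app4 sf (is_derive_const x t) (is_derive_self x)
  (is_derive_dx t x su) (is_derive_dx t x sv))).
by rewrite mulr1 mulr0 add0r /jet_comp.
Qed.

(** The total derivatives of the first partials stay unexpanded, and no mixed partials are merged:
    this is the shape of [total_xx]. *)
Lemma dxx_jet_comp f u v t x : smooth4 f -> smooth2 u -> smooth2 v ->
  dx (dx (jet_comp f u v)) t x =
    dx (jet_comp (d2 f) u v) t x +
    (dx (jet_comp (d3 f) u v) t x * dx u t x + jet_comp (d3 f) u v t x * dx (dx u) t x) +
    (dx (jet_comp (d4 f) u v) t x * dx v t x + jet_comp (d4 f) u v t x * dx (dx v) t x).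
Proof.
move=> sf su sv; rewrite dx_jet_comp //; notypeclasses refine (dxE _).
have H g : smooth4 g -> is_derive x (1 : R) (fun y => jet_comp g u v t y)
    (dx (jet_comp g u v) t x).
  by move=> sg; apply: is_derive_dx; exact: smooth2_jet_comp.
have h2 := H _ (smooth4_d2 sf).
have h3 := H _ (smooth4_d3 sf).
have h4 := H _ (smooth4_d4 sf).
have hu := is_derive_dx t x (smooth2_dx su).
have hv := is_derive_dx t x (smooth2_dx sv).
by derive_by.
Qed.

(** Differentiating the characteristic produces T w_tt + X w_xt with a minus sign, exactly what the
    prolongation formula adds back; only first derivatives of [w] survive. *)
Lemma pr_t_characteristic (a T X w : R -> R -> R) t x :
  smooth2 a -> smooth2 T -> smooth2 X -> smooth2 w ->
  dt (fun t x => a t x - T t x * dt w t x - X t x * dx w t x) t x +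
    T t x * dt (dt w) t x + X t x * dx (dt w) t x =
  dt a t x - dt T t x * dt w t x - dt X t x * dx w t x.
Proof.
move=> sa sT sX sw.
have ha := is_derive_dt t x sa.
have hT := is_derive_dt t x sT.
have hX := is_derive_dt t x sX.
have ht := is_derive_dt t x (smooth2_dt sw).
have hx := is_derive_dt t x (smooth2_dx sw).
have -> : dt (fun t x => a t x - T t x * dt w t x - X t x * dx w t x) t x =
   dt a t x - (dt T t x * dt w t x + T t x * dt (dt w) t x) -
   (dt X t x * dx w t x + X t x * dt (dx w) t x).
  by notypeclasses refine (dtE _); derive_by.
by rewrite dt_dx //; gen_atoms; ring.
Qed.

(** Here [w1], [w2], [w3], [w4] stand for w_t, w_x, w_tx, w_xx and [T1], [X1] for T_x, X_x; the
    product rule is run on plain functions of one variable. *)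
Let is_derive_dx_characteristic (a T T1 X X1 w1 w2 w3 w4 : R -> R)
    (x a' T' T1' X' X1' w1' w2' w3' w4' : R) :
  is_derive x (1 : R) a a' -> is_derive x (1 : R) T T' -> is_derive x (1 : R) X X' ->
  is_derive x (1 : R) T1 T1' -> is_derive x (1 : R) X1 X1' ->
  is_derive x (1 : R) w1 w1' -> is_derive x (1 : R) w2 w2' ->
  is_derive x (1 : R) w3 w3' -> is_derive x (1 : R) w4 w4' ->
  is_derive x (1 : R)
    (fun y => a y - (T1 y * w1 y + T y * w3 y) - (X1 y * w2 y + X y * w4 y))
    (a' - (T1' * w1 x + T1 x * w1' + (T' * w3 x + T x * w3'))
        - (X1' * w2 x + X1 x * w2' + (X' * w4 x + X x * w4'))).
Proof. by move=> *; derive_by. Qed.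

(** The same cancellation one order higher: the third derivatives T w_txx and X w_xxx drop out once
    t- and x-derivatives are commuted. *)
Lemma pr_xx_characteristic (a T X w : R -> R -> R) t x :
  smooth2 a -> smooth2 T -> smooth2 X -> smooth2 w ->
  dx (dx (fun t x => a t x - T t x * dt w t x - X t x * dx w t x)) t x +
    T t x * dt (dx (dx w)) t x + X t x * dx (dx (dx w)) t x =
  dx (dx a) t x - dx (dx T) t x * dt w t x - 2 * dx T t x * dx (dt w) t x
  - dx (dx X) t x * dx w t x - 2 * dx X t x * dx (dx w) t x.
Proof.
move=> sa sT sX sw.
have -> : dx (fun t x => a t x - T t x * dt w t x - X t x * dx w t x) = fun t x =>
    dx a t x - (dx T t x * dt w t x + T t x * dx (dt w) t x) -
    (dx X t x * dx w t x + X t x * dx (dx w) t x).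
  apply/funext => s; apply/funext => y.
  have ha := is_derive_dx s y sa.
  have hT := is_derive_dx s y sT.
  have hX := is_derive_dx s y sX.
  have ht := is_derive_dx s y (smooth2_dt sw).
  have hx := is_derive_dx s y (smooth2_dx sw).
  by notypeclasses refine (dxE _); derive_by.
have -> : dx (fun t x => dx a t x - (dx T t x * dt w t x + T t x * dx (dt w) t x) -
    (dx X t x * dx w t x + X t x * dx (dx w) t x)) t x =
   dx (dx a) t x - (dx (dx T) t x * dt w t x + 2 * dx T t x * dx (dt w) t x
     + T t x * dx (dx (dt w)) t x) -
    (dx (dx X) t x * dx w t x + 2 * dx X t x * dx (dx w) t x
     + X t x * dx (dx (dx w)) t x).
  have ha := is_derive_dx t x (smooth2_dx sa).
  have hT := is_derive_dx t x sT.
  have hX := is_derive_dx t x sX.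
  have hTx := is_derive_dx t x (smooth2_dx sT).
  have hXx := is_derive_dx t x (smooth2_dx sX).
  have ht := is_derive_dx t x (smooth2_dt sw).
  have hx := is_derive_dx t x (smooth2_dx sw).
  have htx := is_derive_dx t x (smooth2_dx (smooth2_dt sw)).
  have hxx := is_derive_dx t x (smooth2_dx (smooth2_dx sw)).
  notypeclasses refine (dxE _).
  notypeclasses refine (is_derive_eq
    (is_derive_dx_characteristic ha hT hX hTx hXx ht hx htx hxx) _).
  by gen_atoms; ring.
rewrite (dt_dx (smooth2_dx sw)) (dt_dx sw); gen_atoms; ring.
Qed.

End Prolongation.

(** * The invariance criterion without third derivatives, and its form for affine fields *)

Section Criterion.
Variable R : realType.
Implicit Types (gamma : R -> R) (u v f g : R -> R -> R) (Q : vfield R).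

Lemma prQ_Delta1E gamma Q u v t x : smooth_vf Q -> smooth2 u -> smooth2 v ->
  let T := jet_comp (vf_t Q) u v in let X := jet_comp (vf_x Q) u v in
  let A := jet_comp (vf_u Q) u v in let B := jet_comp (vf_v Q) u v in
  prQ_Delta1 gamma Q u v t x =
  - (dt B t x - dt T t x * dt v t x - dt X t x * dx v t x)
  + (dx (dx A) t x - dx (dx T) t x * dt u t x - 2 * dx T t x * dx (dt u) t x
     - dx (dx X) t x * dx u t x - 2 * dx X t x * dx (dx u) t x)
  - derive1 gamma t * T t x * x * v t x - gamma t * X t x * v t x
  - gamma t * x * B t x.
Proof.
move=> [sT sX sA sB] su sv T X A B.
have E1 : pr_t Q u v v (char_v Q u v) t x =
    dt B t x - dt T t x * dt v t x - dt X t x * dx v t x.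
  by apply: pr_t_characteristic => //; exact: smooth2_jet_comp.
have E2 : pr_xx Q u v u (char_u Q u v) t x =
    dx (dx A) t x - dx (dx T) t x * dt u t x - 2 * dx T t x * dx (dt u) t x
     - dx (dx X) t x * dx u t x - 2 * dx X t x * dx (dx u) t x.
  by apply: pr_xx_characteristic => //; exact: smooth2_jet_comp.
by rewrite /prQ_Delta1 E1 E2.
Qed.

Lemma prQ_Delta2E gamma Q u v t x : smooth_vf Q -> smooth2 u -> smooth2 v ->
  let T := jet_comp (vf_t Q) u v in let X := jet_comp (vf_x Q) u v in
  let A := jet_comp (vf_u Q) u v in let B := jet_comp (vf_v Q) u v in
  prQ_Delta2 gamma Q u v t x =
  (dt A t x - dt T t x * dt u t x - dt X t x * dx u t x)
  + (dx (dx B) t x - dx (dx T) t x * dt v t x - 2 * dx T t x * dx (dt v) t x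
     - dx (dx X) t x * dx v t x - 2 * dx X t x * dx (dx v) t x)
  + derive1 gamma t * T t x * x * u t x + gamma t * X t x * u t x
  + gamma t * x * A t x.
Proof.
move=> [sT sX sA sB] su sv T X A B.
have E1 : pr_t Q u v u (char_u Q u v) t x =
    dt A t x - dt T t x * dt u t x - dt X t x * dx u t x.
  by apply: pr_t_characteristic => //; exact: smooth2_jet_comp.
have E2 : pr_xx Q u v v (char_v Q u v) t x =
    dx (dx B) t x - dx (dx T) t x * dt v t x - 2 * dx T t x * dx (dt v) t x
     - dx (dx X) t x * dx v t x - 2 * dx X t x * dx (dx v) t x.
  by apply: pr_xx_characteristic => //; exact: smooth2_jet_comp.
by rewrite /prQ_Delta2 E1 E2.
Qed.

Lemma dx_zero t x : dx (fun _ _ : R => 0 : R) t x = 0.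
Proof. exact: derive1_eq (is_derive_const x 0). Qed.

Lemma dt_zero t x : dt (fun _ _ : R => 0 : R) t x = 0.
Proof. exact: derive1_eq (is_derive_const t 0). Qed.

Lemma dt_add f g t x : smooth2 f -> smooth2 g ->
  dt (fun t x => f t x + g t x) t x = dt f t x + dt g t x.
Proof.
by move=> sf sg; exact: dtE (is_derive_add (is_derive_dt t x sf) (is_derive_dt t x sg)).
Qed.

Lemma dt_sub f g t x : smooth2 f -> smooth2 g ->
  dt (fun t x => f t x - g t x) t x = dt f t x - dt g t x.
Proof.
by move=> sf sg; exact: dtE (is_derive_sub (is_derive_dt t x sf) (is_derive_dt t x sg)).
Qed.

Lemma dt_mul f g t x : smooth2 f -> smooth2 g ->
  dt (fun t x => f t x * g t x) t x = dt f t x * g t x + f t x * dt g t x.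
Proof.
by move=> sf sg; exact: dtE (is_derive_mul (is_derive_dt t x sf) (is_derive_dt t x sg)).
Qed.

Lemma dx_add f g : smooth2 f -> smooth2 g ->
  dx (fun t x => f t x + g t x) = fun t x => dx f t x + dx g t x.
Proof.
move=> sf sg; apply/funext => t; apply/funext => x.
exact: dxE (is_derive_add (is_derive_dx t x sf) (is_derive_dx t x sg)).
Qed.

Lemma dx_sub f g : smooth2 f -> smooth2 g ->
  dx (fun t x => f t x - g t x) = fun t x => dx f t x - dx g t x.
Proof.
move=> sf sg; apply/funext => t; apply/funext => x.
exact: dxE (is_derive_sub (is_derive_dx t x sf) (is_derive_dx t x sg)).
Qed.

Lemma dx_mul f g : smooth2 f -> smooth2 g ->
  dx (fun t x => f t x * g t x) = fun t x => dx f t x * g t x + f t x * dx g t x.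
Proof.
move=> sf sg; apply/funext => t; apply/funext => x.
exact: dxE (is_derive_mul (is_derive_dx t x sf) (is_derive_dx t x sg)).
Qed.

Lemma dxx_add f g t x : smooth2 f -> smooth2 g ->
  dx (dx (fun t x => f t x + g t x)) t x = dx (dx f) t x + dx (dx g) t x.
Proof.
move=> sf sg; rewrite (dx_add sf sg).
by rewrite (dx_add (smooth2_dx sf) (smooth2_dx sg)).
Qed.

Lemma dxx_sub f g t x : smooth2 f -> smooth2 g ->
  dx (dx (fun t x => f t x - g t x)) t x = dx (dx f) t x - dx (dx g) t x.
Proof.
move=> sf sg; rewrite (dx_sub sf sg).
by rewrite (dx_sub (smooth2_dx sf) (smooth2_dx sg)).
Qed.

Lemma smooth2_mul f g : smooth2 f -> smooth2 g -> smooth2 (fun t x => f t x * g t x).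
Proof. exact: smoothn_mul. Qed.

Lemma smooth2_sub f g : smooth2 f -> smooth2 g -> smooth2 (fun t x => f t x - g t x).
Proof. exact: smoothn_sub. Qed.

Lemma smooth2_add f g : smooth2 f -> smooth2 g -> smooth2 (fun t x => f t x + g t x).
Proof. exact: smoothn_add. Qed.

Lemma dxx_mul f g t x : smooth2 f -> smooth2 g ->
  dx (dx (fun t x => f t x * g t x)) t x =
  dx (dx f) t x * g t x + 2 * dx f t x * dx g t x + f t x * dx (dx g) t x.
Proof.
move=> sf sg; rewrite (dx_mul sf sg).
have sf' := smooth2_dx sf; have sg' := smooth2_dx sg.
rewrite (dx_add (smooth2_mul sf' sg) (smooth2_mul sf sg')).
by rewrite (dx_mul sf' sg) (dx_mul sf sg'); gen_atoms; ring.
Qed.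

(** In complex form the coefficient of d_psi is (r + i S) psi + (a + i b). *)
Definition affine_vf (T X r S a b : R -> R -> R) : vfield R :=
  VF (fun t x _ _ => T t x) (fun t x _ _ => X t x)
     (fun t x p q => r t x * p - S t x * q + a t x)
     (fun t x p q => S t x * p + r t x * q + b t x).

Lemma smooth_affine_vf (T X r S a b : R -> R -> R) :
  smooth2 T -> smooth2 X -> smooth2 r -> smooth2 S -> smooth2 a -> smooth2 b ->
  smooth_vf (affine_vf T X r S a b).
Proof. by move=> *; split=> /=; smooth_rules. Qed.

(** In complex form the right-hand sides are the real and imaginary parts of (- S_t + i W) psi plus
    the left-hand side of the equation at a + i b. The four differential hypotheses are what cancels
    every term in u_x, u_xx, u_tx and their analogues for v. *)
Lemma prQ_affine gamma (T X r S a b : R -> R -> R) u v t x :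
  smooth2 T -> smooth2 X -> smooth2 r -> smooth2 S -> smooth2 a -> smooth2 b ->
  (forall t x, dx T t x = 0) -> (forall t x, dx X t x = 2^-1 * dt T t x) ->
  (forall t x, dx r t x = 0) -> (forall t x, dx S t x = 2^-1 * dt X t x) ->
  smooth2 u -> smooth2 v ->
  Delta1 gamma u v t x = 0 -> Delta2 gamma u v t x = 0 ->
  let W := dt r t x + dx (dx S) t x + dt T t x * gamma t * x
           + derive1 gamma t * T t x * x + gamma t * X t x in
  prQ_Delta1 gamma (affine_vf T X r S a b) u v t x =
    - dt S t x * u t x - W * v t x + Delta1 gamma a b t x /\
  prQ_Delta2 gamma (affine_vf T X r S a b) u v t x =
    W * u t x - dt S t x * v t x + Delta2 gamma a b t x.
Proof.
move=> sT sX sr sS sa sb Tx Xx rx Sx su sv e1 e2 W.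
have sQ := smooth_affine_vf sT sX sr sS sa sb.
rewrite prQ_Delta1E // prQ_Delta2E //.
have -> : jet_comp (vf_t (affine_vf T X r S a b)) u v = T by [].
have -> : jet_comp (vf_x (affine_vf T X r S a b)) u v = X by [].
have -> : jet_comp (vf_u (affine_vf T X r S a b)) u v =
  fun t x => r t x * u t x - S t x * v t x + a t x by [].
have -> : jet_comp (vf_v (affine_vf T X r S a b)) u v =
  fun t x => S t x * u t x + r t x * v t x + b t x by [].
have sru := smooth2_mul sr su; have srv := smooth2_mul sr sv.
have sSu := smooth2_mul sS su; have sSv := smooth2_mul sS sv.
rewrite (dt_add _ _ (smooth2_sub sru sSv) sa) (dt_sub _ _ sru sSv).
rewrite (dt_add _ _ (smooth2_add sSu srv) sb) (dt_add _ _ sSu srv).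
rewrite (dt_mul _ _ sr su) (dt_mul _ _ sr sv) (dt_mul _ _ sS su) (dt_mul _ _ sS sv).
rewrite (dxx_add _ _ (smooth2_sub sru sSv) sa) (dxx_sub _ _ sru sSv).
rewrite (dxx_add _ _ (smooth2_add sSu srv) sb) (dxx_add _ _ sSu srv).
rewrite (dxx_mul _ _ sr su) (dxx_mul _ _ sr sv) (dxx_mul _ _ sS su) (dxx_mul _ _ sS sv).
have dx0 (f : R -> R -> R) : (forall t x, dx f t x = 0) -> dx (dx f) t x = 0.
  move=> f0; rewrite (_ : dx f = fun _ _ => 0); first exact: dx_zero.
  by apply/funext => s; apply/funext => y.
(* X_xx = T_tx / 2, and T_x = 0. *)
have Xxx : dx (dx X) t x = 0.
  have -> : dx X = fun t x => 2^-1 * dt T t x by apply/funext => s; apply/funext.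
  have H := is_derive_mul (is_derive_const x (2^-1)) (is_derive_dx t x (smooth2_dt sT)).
  rewrite (@dxE _ (fun t x => 2^-1 * dt T t x) t x _ H) -(dt_dx sT).
  have -> : dt (dx T) t x = 0.
    rewrite (_ : dx T = fun _ _ => 0); first exact: dt_zero.
    by apply/funext => s; apply/funext => y.
  by rewrite mul0r mulr0 addr0.
rewrite !(dx0 T) // !(dx0 r) // Xxx Tx Xx rx Sx /W.
move: e1 e2; rewrite /Delta1 /Delta2.
move: (dx (dx u) t x) (dx (dx v) t x) (dt u t x) (dt v t x) => uxx vxx ut vt.
gen_atoms.
move: (T t x) (X t x) (r t x) (S t x) (a t x) (b t x) (u t x) (v t x) (gamma t).
move=> T0 X0 r0 S0 a0 b0 u0 v0 g e1 e2.
have -> : vt = uxx - g * x * v0 by lra.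
have -> : ut = - vxx - g * x * u0 by lra.
by split; field.
Qed.

(* Polynomials realize all the jets that enter the criterion. *)
Lemma jet_realization (t x p pt px pxx ptx : R) : exists2 u, smooth2 u &
  [/\ u t x = p, dt u t x = pt, dx u t x = px, dx (dx u) t x = pxx & dx (dt u) t x = ptx].
Proof.
pose u s y := p + pt * (s - t) + px * (y - x) + 2^-1 * pxx * (y - x) ^+ 2
  + ptx * ((s - t) * (y - x)).
have su : smooth2 u by rewrite /u; smooth_rules.
have Et : dt u = fun s y => pt + ptx * (y - x).
  apply/funext => s; apply/funext => y; notypeclasses refine (dtE _); rewrite /u.
  by derive_by; rewrite /=; ring.
have Ex : dx u = fun s y => px + pxx * (y - x) + ptx * (s - t).
  apply/funext => s; apply/funext => y; notypeclasses refine (dxE _); rewrite /u.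
  under eq_fun do rewrite expr2.
  by derive_by; rewrite /=; field.
exists u => //; split.
- by rewrite /u !subrr; ring.
- by rewrite Et subrr; ring.
- by rewrite Ex !subrr; ring.
- rewrite Ex; notypeclasses refine (dxE _); derive_by; rewrite /=; ring.
- rewrite Et; notypeclasses refine (dxE _); derive_by; rewrite /=; ring.
Qed.

End Criterion.

(** * Determining equations *)

Section DeterminingEquations.
Variable R : realType.

(* jab is the derivative in b of the derivative in a, with t, x, u, v for the
   coordinates of the space of (t, x, psi). *)
Record jet2 := Jet2 { j0 : R; jt : R; jx : R; ju : R; jv : R;
  jxx : R; jxu : R; jxv : R; jux : R; juu : R; juv : R; jvx : R; jvu : R; jvv : R }.

Definition jet2_of (f : R -> R -> R -> R -> R) (t x p q : R) : jet2 :=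
  Jet2 (f t x p q) (d1 f t x p q) (d2 f t x p q) (d3 f t x p q) (d4 f t x p q)
    (d2 (d2 f) t x p q) (d3 (d2 f) t x p q) (d4 (d2 f) t x p q)
    (d2 (d3 f) t x p q) (d3 (d3 f) t x p q) (d4 (d3 f) t x p q)
    (d2 (d4 f) t x p q) (d3 (d4 f) t x p q) (d4 (d4 f) t x p q).

Definition total_t (j : jet2) (pt qt : R) := jt j + ju j * pt + jv j * qt.
Definition total_x (j : jet2) (px qx : R) := jx j + ju j * px + jv j * qx.
Definition total_xx (j : jet2) (px qx pxx qxx : R) :=
  (jxx j + jxu j * px + jxv j * qx)
  + ((jux j + juu j * px + juv j * qx) * px + ju j * pxx)
  + ((jvx j + jvu j * px + jvv j * qx) * qx + jv j * qxx).

(** [p], [q] are the values of u, v. The time derivatives [pt], [qt] are those forced by the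
    equation; the other derivatives are free parameters. *)
Definition criterion1 (T X A B : jet2) (g g' x p q px qx pxx qxx ptx qtx : R) :=
  let pt := - qxx - g * x * p in let qt := pxx - g * x * q in
  - (total_t B pt qt - total_t T pt qt * qt - total_t X pt qt * qx)
  + (total_xx A px qx pxx qxx - total_xx T px qx pxx qxx * pt
     - 2 * total_x T px qx * ptx - total_xx X px qx pxx qxx * px
     - 2 * total_x X px qx * pxx)
  - g' * j0 T * x * q - g * j0 X * q - g * x * j0 B.

Definition criterion2 (T X A B : jet2) (g g' x p q px qx pxx qxx ptx qtx : R) :=
  let pt := - qxx - g * x * p in let qt := pxx - g * x * q in
  (total_t A pt qt - total_t T pt qt * pt - total_t X pt qt * px)
  + (total_xx B px qx pxx qxx - total_xx T px qx pxx qxx * qt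
     - 2 * total_x T px qx * qtx - total_xx X px qx pxx qxx * qx
     - 2 * total_x X px qx * qxx)
  + g' * j0 T * x * p + g * j0 X * p + g * x * j0 A.

Definition criterion (T X A B : jet2) (g g' x p q : R) :=
  forall px qx pxx qxx ptx qtx,
    criterion1 T X A B g g' x p q px qx pxx qxx ptx qtx = 0 /\
    criterion2 T X A B g g' x p q px qx pxx qxx ptx qtx = 0.

(** Polynomials are chosen with the prescribed free derivatives and with the time derivatives forced
    by the equation. The equation then holds at the single point [(t, x)], which is all that
    [lie_symmetry] asks for. *)
Lemma symmetry_criterion (gamma : R -> R) (Q : vfield R) (t x p q : R) :
  lie_symmetry gamma Q ->
  criterion (jet2_of (vf_t Q) t x p q) (jet2_of (vf_x Q) t x p q)
    (jet2_of (vf_u Q) t x p q) (jet2_of (vf_v Q) t x p q)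
    (gamma t) (derive1 gamma t) x p q.
Proof.
move=> [sQ LQ] px qx pxx qxx ptx qtx.
pose pt := - qxx - gamma t * x * p; pose qt := pxx - gamma t * x * q.
have [u su [u0 ut ux uxx utx]] := jet_realization t x p pt px pxx ptx.
have [v sv [v0 vt vx vxx vtx]] := jet_realization t x q qt qx qxx qtx.
have e1 : Delta1 gamma u v t x = 0.
  by rewrite /Delta1 vt uxx v0 /qt; ring.
have e2 : Delta2 gamma u v t x = 0.
  by rewrite /Delta2 ut vxx u0 /pt; ring.
have := LQ u v su sv t x e1 e2.
have [sT sX sA sB] := sQ.
rewrite (prQ_Delta1E _ _ _ sQ su sv) (prQ_Delta2E _ _ _ sQ su sv).
have Ct f : smooth4 f ->
    dt (jet_comp f u v) t x = total_t (jet2_of f t x p q) pt qt.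
  by move=> sf; rewrite (dt_jet_comp sf su sv) /jet_comp u0 v0 ut vt.
have Cx f : smooth4 f ->
    dx (jet_comp f u v) t x = total_x (jet2_of f t x p q) px qx.
  by move=> sf; rewrite (dx_jet_comp sf su sv) /jet_comp u0 v0 ux vx.
have Cxx f : smooth4 f ->
    dx (dx (jet_comp f u v)) t x = total_xx (jet2_of f t x p q) px qx pxx qxx.
  move=> sf; rewrite (dxx_jet_comp _ _ sf su sv) ux vx uxx vxx.
  rewrite (Cx _ (smooth4_d2 sf)) (Cx _ (smooth4_d3 sf)) (Cx _ (smooth4_d4 sf)).
  by rewrite /jet_comp u0 v0.
rewrite (Ct _ sT) (Ct _ sX) (Ct _ sA) (Ct _ sB) (Cx _ sT) (Cx _ sX).
rewrite (Cxx _ sT) (Cxx _ sX) (Cxx _ sA) (Cxx _ sB).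
by rewrite /jet_comp ut vt ux vx uxx vxx utx vtx u0 v0.
Qed.

Section Algebra.
Variables (T X A B : jet2) (g g' x p q : R).
Hypothesis C : criterion T X A B g g' x p q.

Ltac use_criterion1 px qx pxx qxx ptx := let E := fresh "E" in
  have [E _] := C px qx pxx qxx ptx (0 : R);
  rewrite /criterion1 /total_t /total_x /total_xx in E.
(** The parameter [ptx] occurs only as [- 2 * total_x T px qx * ptx]. Comparing [ptx = 0] with
    [ptx = 1] kills [total_x T] at [(px, qx)] equal to (0, 0), (1, 0) and (0, 1). *)
Lemma criterion_T : [/\ jx T = 0, ju T = 0 & jv T = 0].
Proof.
have Tx : jx T = 0.
  use_criterion1 (0 : R) (0 : R) (0 : R) (0 : R) (0 : R).
  use_criterion1 (0 : R) (0 : R) (0 : R) (0 : R) (1 : R).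
  lra.
split=> //.
  use_criterion1 (1 : R) (0 : R) (0 : R) (0 : R) (0 : R).
  use_criterion1 (1 : R) (0 : R) (0 : R) (0 : R) (1 : R).
  lra.
use_criterion1 (0 : R) (1 : R) (0 : R) (0 : R) (0 : R).
use_criterion1 (0 : R) (1 : R) (0 : R) (0 : R) (1 : R).
lra.
Qed.

(** At a single point the vanishing of first derivatives says nothing about second ones. They enter
    as hypotheses, met in [symmetry_affine] once the first-order conclusion is known at all
    points. *)
Hypothesis T_1 : [/\ jx T = 0, ju T = 0 & jv T = 0].
Hypothesis T_x2 : [/\ jxx T = 0, jxu T = 0 & jxv T = 0].
Hypothesis T_u2 : [/\ jux T = 0, juu T = 0 & juv T = 0].
Hypothesis T_v2 : [/\ jvx T = 0, jvu T = 0 & jvv T = 0].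

(* The criterion for T depending on t only. *)
Let C_T px qx pxx qxx : let pt := - qxx - g * x * p in let qt := pxx - g * x * q in
  - (total_t B pt qt - jt T * qt - total_t X pt qt * qx)
    + (total_xx A px qx pxx qxx - total_xx X px qx pxx qxx * px
       - 2 * total_x X px qx * pxx)
    - g' * j0 T * x * q - g * j0 X * q - g * x * j0 B = 0 /\
  (total_t A pt qt - jt T * pt - total_t X pt qt * px)
    + (total_xx B px qx pxx qxx - total_xx X px qx pxx qxx * qx
       - 2 * total_x X px qx * qxx)
    + g' * j0 T * x * p + g * j0 X * p + g * x * j0 A = 0.
Proof.
have Tt pt qt : total_t T pt qt = jt T.
  by rewrite /total_t; have [_ -> ->] := T_1; rewrite !mul0r !addr0.
have Tx : total_x T px qx = 0.
  by rewrite /total_x; have [-> -> ->] := T_1; rewrite !mul0r !addr0.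
have Txx : total_xx T px qx pxx qxx = 0.
  rewrite /total_xx; have [_ -> ->] := T_1; have [-> -> ->] := T_x2.
  by have [-> -> ->] := T_u2; have [-> -> ->] := T_v2; rewrite !(mul0r, addr0).
have := C px qx pxx qxx 0 0.
by rewrite /criterion1 /criterion2 !Tt Tx Txx !(mul0r, mulr0, subr0).
Qed.

Ltac use_C_T px qx pxx qxx := let E := fresh "E" in let E' := fresh "E" in
  have [E E'] := C_T px qx pxx qxx;
  rewrite /total_t /total_x /total_xx ?(mul0r, mulr0, addr0, add0r, subr0, sub0r, mulr1) in E E'.

(** At [px = qx = 0] the coefficients of [pxx] and [qxx] in the two equations give X_x = T_t / 2 and
    the Cauchy-Riemann type relations between A and B. Moving to [(px, qx)] = (1, 0) or (0, 1)
    changes the coefficient of [pxx] in the first equation by - 3 X_u or - X_v. *)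
Lemma criterion_X :
  [/\ ju X = 0, jv X = 0, jx X = 2^-1 * jt T, ju A = jv B & jv A = - ju B].
Proof.
use_C_T (0 : R) (0 : R) (0 : R) (0 : R).
use_C_T (0 : R) (0 : R) (1 : R) (0 : R).
use_C_T (0 : R) (0 : R) (0 : R) (1 : R).
have [XE AB AB'] : [/\ jx X = 2^-1 * jt T, ju A = jv B & jv A = - ju B].
  by split; lra.
clear E2 E0 E3 E4.
split=> //.
  use_C_T (1 : R) (0 : R) (0 : R) (0 : R).
  use_C_T (1 : R) (0 : R) (1 : R) (0 : R).
  lra.
use_C_T (0 : R) (1 : R) (0 : R) (0 : R).
use_C_T (0 : R) (1 : R) (1 : R) (0 : R).
lra.
Qed.

Hypothesis X_1 : [/\ ju X = 0, jv X = 0, jx X = 2^-1 * jt T, ju A = jv B & jv A = - ju B].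
Hypothesis X_x2 : [/\ jxx X = 0, jxu X = 0 & jxv X = 0].
Hypothesis X_u2 : [/\ jux X = 0, juu X = 0 & juv X = 0].
Hypothesis X_v2 : [/\ jvx X = 0, jvu X = 0 & jvv X = 0].

(** With [pxx = qxx = 0] and one of [px], [qx] zero, the criterion is a quadratic polynomial in the
    other; its values at 0, 1 and - 1 separate the coefficients. The linear ones appear as sums of
    two mixed partials, whose symmetry is used only later. *)
Lemma criterion_AB : [/\ juu A = 0, jvv A = 0, juu B = 0 & jvv B = 0] /\
  [/\ jxu A + jux A = 0, jxv A + jvx A = - jt X,
      jxu B + jux B = jt X & jxv B + jvx B = 0].
Proof.
have Xt pt qt : total_t X pt qt = jt X.
  by rewrite /total_t; have [-> -> _ _ _] := X_1; rewrite !mul0r !addr0.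
have Xxx px qx pxx qxx : total_xx X px qx pxx qxx = 0.
  rewrite /total_xx; have [-> -> _ _ _] := X_1; have [-> -> ->] := X_x2.
  by have [-> -> ->] := X_u2; have [-> -> ->] := X_v2; rewrite !(mul0r, addr0).
have [E1 E2] := C_T 0 0 0 0.
have [E3 E4] := C_T 1 0 0 0; have [E5 E6] := C_T (- 1) 0 0 0.
have [E7 E8] := C_T 0 1 0 0; have [E9 E10] := C_T 0 (- 1) 0 0.
rewrite !Xt !Xxx in E1 E2 E3 E4 E5 E6 E7 E8 E9 E10.
rewrite /total_t /total_xx !(mul0r, mulr0, addr0, add0r, subr0, sub0r, mulr1)
  in E1 E2 E3 E4 E5 E6 E7 E8 E9 E10.
have [] : juu A = 0 /\ jxu A + jux A = 0 by split; lra.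
have [] : juu B = 0 /\ jxu B + jux B = jt X by split; lra.
have [] : jvv A = 0 /\ jxv A + jvx A = - jt X by split; lra.
have [] : jvv B = 0 /\ jxv B + jvx B = 0 by split; lra.
by [].
Qed.

End Algebra.

End DeterminingEquations.

(** * From the pointwise determining equations to the affine form of a symmetry *)

Section AffineForm.
Variable R : realType.
Implicit Types (f : R -> R -> R -> R -> R) (w : R -> R).

Lemma fun4_eq f g : (forall t x p q, f t x p q = g t x p q) -> f = g.
Proof.
by move=> E; apply/funext => t; apply/funext => x; apply/funext => p; apply/funext => q.
Qed.

Lemma d2_const w t x p q : d2 (fun t _ _ _ => w t) t x p q = 0.
Proof. exact: derive1_eq (is_derive_const x (w t)). Qed.

Lemma d3_const w t x p q : d3 (fun t _ _ _ => w t) t x p q = 0.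
Proof. exact: derive1_eq (is_derive_const p (w t)). Qed.

Lemma d4_const w t x p q : d4 (fun t _ _ _ => w t) t x p q = 0.
Proof. exact: derive1_eq (is_derive_const q (w t)). Qed.

Lemma affine_x f w t x p q : smooth4 f ->
  (forall y, d2 f t y p q = w t) -> f t x p q = f t 0 p q + w t * x.
Proof.
move=> sf E.
have H y : is_derive y (1 : R) (fun y => f t y p q - w t * y) 0.
  notypeclasses refine (is_derive_eq (is_derive_sub (is_derive_d2 t y p q sf)
    (is_derive_mul (is_derive_const y (w t)) (is_derive_self y))) _).
  by rewrite E; ring.
have := @is_derive_0_is_cst _ _ x 0 H; lra.
Qed.

Lemma affine_u f (k t x p q : R) : smooth4 f ->
  (forall y, d3 f t x y q = k) -> f t x p q = f t x 0 q + k * p.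
Proof.
move=> sf E.
have H y : is_derive y (1 : R) (fun y => f t x y q - k * y) 0.
  notypeclasses refine (is_derive_eq (is_derive_sub (is_derive_d3 t x y q sf)
    (is_derive_mul (is_derive_const y k) (is_derive_self y))) _).
  by rewrite E; ring.
have := @is_derive_0_is_cst _ _ p 0 H; lra.
Qed.

Lemma affine_v f (k t x p q : R) : smooth4 f ->
  (forall y, d4 f t x p y = k) -> f t x p q = f t x p 0 + k * q.
Proof.
move=> sf E.
have H y : is_derive y (1 : R) (fun y => f t x p y - k * y) 0.
  notypeclasses refine (is_derive_eq (is_derive_sub (is_derive_d4 t x p y sf)
    (is_derive_mul (is_derive_const y k) (is_derive_self y))) _).
  by rewrite E; ring.
have := @is_derive_0_is_cst _ _ q 0 H; lra.
Qed.

Lemma smooth2_slice f : smooth4 f -> smooth2 (fun t x => f t x 0 0).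
Proof. by move=> sf; smooth_rules. Qed.

Lemma symmetry_affine (gamma : R -> R) (Q : vfield R) : lie_symmetry gamma Q ->
  exists T X r S a b : R -> R -> R, Q = affine_vf T X r S a b /\
    [/\ smooth2 T, smooth2 X, smooth2 r & smooth2 S] /\ smooth2 a /\ smooth2 b /\
    [/\ forall t x, dx T t x = 0, forall t x, dx X t x = 2^-1 * dt T t x,
        forall t x, dx r t x = 0 & forall t x, dx S t x = 2^-1 * dt X t x].
Proof.
move=> LQ; have C t x p q := symmetry_criterion t x p q LQ.
have [[sT sX sA sB] _] := LQ; case: Q C sT sX sA sB {LQ} => T X A B /= C sT sX sA sB.
have CT t x p q := criterion_T (C t x p q); rewrite /= in CT.
have T2 : d2 T = fun _ _ _ _ => 0 by apply: fun4_eq => t x p q; have [] := CT t x p q.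
have T3 : d3 T = fun _ _ _ _ => 0 by apply: fun4_eq => t x p q; have [] := CT t x p q.
have T4 : d4 T = fun _ _ _ _ => 0 by apply: fun4_eq => t x p q; have [] := CT t x p q.
(* The first partials in x, u, v vanish everywhere, so [T] may be evaluated at x = u = v = 0; hence
   X_x below depends on t alone and the second partials of [X] vanish too. *)
have TE : T = fun t _ _ _ => T t 0 0 0.
  apply: fun4_eq => t x p q.
  rewrite (@affine_v T 0 t x p q sT) ?T4 // (@affine_u T 0 t x p 0 sT) ?T3 //.
  rewrite (@affine_x T (fun=> 0) t x 0 0 sT) ?T2 //; ring.
have c2 t x p q : d2 (fun _ _ _ _ => 0) t x p q = 0 := d2_const (fun=> 0) t x p q.
have c3 t x p q : d3 (fun _ _ _ _ => 0) t x p q = 0 := d3_const (fun=> 0) t x p q.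
have c4 t x p q : d4 (fun _ _ _ _ => 0) t x p q = 0 := d4_const (fun=> 0) t x p q.
have T22 t x p q : [/\ jxx (jet2_of T t x p q) = 0, jxu (jet2_of T t x p q) = 0 &
    jxv (jet2_of T t x p q) = 0] by rewrite /= T2 c2 c3 c4.
have T33 t x p q : [/\ jux (jet2_of T t x p q) = 0, juu (jet2_of T t x p q) = 0 &
    juv (jet2_of T t x p q) = 0] by rewrite /= T3 c2 c3 c4.
have T44 t x p q : [/\ jvx (jet2_of T t x p q) = 0, jvu (jet2_of T t x p q) = 0 &
    jvv (jet2_of T t x p q) = 0] by rewrite /= T4 c2 c3 c4.
have CX t x p q := criterion_X (C t x p q) (CT t x p q) (T22 t x p q) (T33 t x p q)
  (T44 t x p q).
have X3 : d3 X = fun _ _ _ _ => 0 by apply: fun4_eq => t x p q; have [] := CX t x p q.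
have X4 : d4 X = fun _ _ _ _ => 0 by apply: fun4_eq => t x p q; have [] := CX t x p q.
pose w t := 2^-1 * d1 T t 0 0 0.
have X2 : d2 X = fun t _ _ _ => w t.
  apply: fun4_eq => t x p q; have [_ _ /= -> _ _] := CX t x p q.
  by rewrite /w TE.
have X22 t x p q : [/\ jxx (jet2_of X t x p q) = 0, jxu (jet2_of X t x p q) = 0 &
    jxv (jet2_of X t x p q) = 0] by rewrite /= X2 d2_const d3_const d4_const.
have X33 t x p q : [/\ jux (jet2_of X t x p q) = 0, juu (jet2_of X t x p q) = 0 &
    juv (jet2_of X t x p q) = 0] by rewrite /= X3 c2 c3 c4.
have X44 t x p q : [/\ jvx (jet2_of X t x p q) = 0, jvu (jet2_of X t x p q) = 0 &
    jvv (jet2_of X t x p q) = 0] by rewrite /= X4 c2 c3 c4.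
have CA t x p q := criterion_AB (C t x p q) (CT t x p q) (T22 t x p q) (T33 t x p q)
  (T44 t x p q) (CX t x p q) (X22 t x p q) (X33 t x p q) (X44 t x p q).
rewrite /= in CA; rewrite /= in CX.
have [sA3 sB3 sA4 sB4] : [/\ smooth4 (d3 A), smooth4 (d3 B), smooth4 (d4 A) & smooth4 (d4 B)].
  by split; smooth_rules.
have AB : d3 A = d4 B by apply: fun4_eq => t x p q; have [] := CX t x p q.
have BA t x p q : d3 B t x p q = - d4 A t x p q.
  by have [_ _ _ _ ->] := CX t x p q; rewrite opprK.
pose r t x := d3 A t x 0 0; pose S t x := d3 B t x 0 0.
(* A_u is independent of u because A_uu = 0. Its independence of v comes through B: A_u = B_v and
   B_vv = 0. The same detour, with B_u = - A_v, is used for [S]. *)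
have A3 t x p q : d3 A t x p q = r t x.
  have e1 := @affine_u (d3 A) 0 t x p q sA3
    (fun y => let: conj (And4 H _ _ _) _ := CA t x y q in H).
  have e2 := @affine_v (d4 B) 0 t x 0 q sB4
    (fun y => let: conj (And4 _ _ _ H) _ := CA t x 0 y in H).
  by rewrite e1 {1}AB e2 !mul0r !addr0 -AB.
have B3 t x p q : d3 B t x p q = S t x.
  have e1 := @affine_u (d3 B) 0 t x p q sB3
    (fun y => let: conj (And4 _ _ H _) _ := CA t x y q in H).
  have e2 := @affine_v (d4 A) 0 t x 0 q sA4
    (fun y => let: conj (And4 _ H _ _) _ := CA t x 0 y in H).
  by rewrite e1 BA e2 !mul0r !addr0 -BA.
have B4 t x p q : d4 B t x p q = r t x by rewrite -AB A3.
have A4 t x p q : d4 A t x p q = - S t x by rewrite -(B3 t x p q) BA opprK.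
exists (fun t x => T t x 0 0), (fun t x => X t x 0 0), r, S,
  (fun t x => A t x 0 0), (fun t x => B t x 0 0); split.
  rewrite /affine_vf; congr VF; apply: fun4_eq => t x p q.
  - by rewrite TE.
  - rewrite (@affine_v X 0 t x p q sX) ?X4 // (@affine_u X 0 t x p 0 sX) ?X3 //.
    by rewrite !mul0r !addr0.
  - rewrite (@affine_v A (- S t x) t x p q sA) //.
    by rewrite (@affine_u A (r t x) t x p 0 sA) // mulNr; gen_atoms; ring.
  - rewrite (@affine_v B (r t x) t x p q sB) //.
    by rewrite (@affine_u B (S t x) t x p 0 sB) //; gen_atoms; ring.
split; first by split; exact: smooth2_slice.
split; first exact: smooth2_slice.
split; first exact: smooth2_slice.
split=> t x.
- by have [H _ _] := CT t x 0 0; exact: H.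
- by have [_ _ H _ _] := CX t x 0 0; exact: H.
(* With the mixed partials exchanged, the two summands coincide: the sum is 2 r_x here and 2 S_x in
   the next item. *)
- have [_ [H _ _ _]] := CA t x 0 0; rewrite -(d2_d3 sA) in H.
  have -> : dx r t x = d2 (d3 A) t x 0 0 by [].
  by move: H; gen_atoms; lra.
- have [_ [_ _ H _]] := CA t x 0 0; rewrite -(d2_d3 sB) in H.
  have -> : dx S t x = d2 (d3 B) t x 0 0 by [].
  have -> : dt (fun t x => X t x 0 0) t x = d1 X t x 0 0 by [].
  by move: H; gen_atoms; lra.
Qed.

End AffineForm.

(** * Solution of the determining equations *)

Section Solve.
Variable R : realType.
Implicit Types (gamma : R -> R).

Definition W_coef gamma (T X r S : R -> R -> R) t x :=
  dt r t x + dx (dx S) t x + dt T t x * gamma t * x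
  + derive1 gamma t * T t x * x + gamma t * X t x.

(** By [prQ_affine] the criterion is affine in the values of u and v at the point, and these are
    arbitrary. *)
Lemma affine_symmetryP gamma (T X r S a b : R -> R -> R) :
  smooth2 T -> smooth2 X -> smooth2 r -> smooth2 S -> smooth2 a -> smooth2 b ->
  (forall t x, dx T t x = 0) -> (forall t x, dx X t x = 2^-1 * dt T t x) ->
  (forall t x, dx r t x = 0) -> (forall t x, dx S t x = 2^-1 * dt X t x) ->
  lie_symmetry gamma (affine_vf T X r S a b) <->
  [/\ forall t x, dt S t x = 0, forall t x, W_coef gamma T X r S t x = 0 &
      is_solution gamma a b].
Proof.
move=> sT sX sr sS sa sb Tx Xx rx Sx.
have P u v t x su sv e1 e2 :=
  @prQ_affine R gamma T X r S a b u v t x sT sX sr sS sa sb Tx Xx rx Sx su sv e1 e2.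
split=> [[_ LQ]|[St W0 sol]]; last first.
  split; first exact: smooth_affine_vf.
  move=> u v su sv t x e1 e2; have [-> ->] := P u v t x su sv e1 e2.
  have [-> ->] := sol t x; rewrite -/(W_coef gamma T X r S t x) W0 St.
  by split; ring.
have E t x p q : - dt S t x * p - W_coef gamma T X r S t x * q + Delta1 gamma a b t x = 0 /\
    W_coef gamma T X r S t x * p - dt S t x * q + Delta2 gamma a b t x = 0.
  (* With vanishing x-derivatives the equation only forces u_t = - gamma x u and v_t = - gamma x
     v. *)
  have [u su [u0 ut _ uxx _]] := jet_realization t x p (- (gamma t * x * p)) 0 0 0.
  have [v sv [v0 vt _ vxx _]] := jet_realization t x q (- (gamma t * x * q)) 0 0 0.
  have e1 : Delta1 gamma u v t x = 0 by rewrite /Delta1 vt uxx v0; ring.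
  have e2 : Delta2 gamma u v t x = 0 by rewrite /Delta2 ut vxx u0; ring.
  have [E1 E2] := P u v t x su sv e1 e2.
  have [F1 F2] := LQ u v su sv t x e1 e2.
  by rewrite E1 u0 v0 in F1; rewrite E2 u0 v0 in F2.
have D t x : [/\ dt S t x = 0, W_coef gamma T X r S t x = 0,
    Delta1 gamma a b t x = 0 & Delta2 gamma a b t x = 0].
  (* The values (0, 0) isolate the equation for [(a, b)]; the values (1, 0) then give both
     coefficients. *)
  have [E1 E2] := E t x 0 0; have [E3 E4] := E t x 1 0.
  move: E1 E2 E3 E4.
  move: (dt S t x) (W_coef _ _ _ _ _ _ _) (Delta1 _ _ _ _ _) (Delta2 _ _ _ _ _) => *.
  by split; lra.
by split=> t x; have [] := D t x.
Qed.

Lemma is_derive_dt_eq (u : R -> R -> R) (t x k : R) : smooth2 u -> dt u t x = k ->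
  is_derive t (1 : R) (fun s => u s x) k.
Proof. by move=> su <-; exact: is_derive_dt. Qed.

Lemma is_derive_dx_eq (u : R -> R -> R) (t x k : R) : smooth2 u -> dx u t x = k ->
  is_derive x (1 : R) (fun y => u t y) k.
Proof. by move=> su <-; exact: is_derive_dx. Qed.

Lemma linear_of_derive (f : R -> R) (k : R) :
  (forall t, is_derive t (1 : R) f k) -> forall t, f t = f 0 + k * t.
Proof.
move=> df t.
have H s : is_derive s (1 : R) (fun s => f s - k * s) 0.
  notypeclasses refine (is_derive_eq (is_derive_sub (df s)
    (is_derive_mul (is_derive_const s k) (is_derive_self s))) _); ring.
have := @is_derive_0_is_cst _ _ t 0 H; lra.
Qed.

Lemma quadratic_of_derive (f : R -> R) (k l : R) :
  (forall t, is_derive t (1 : R) f (k + l * t)) ->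
  forall t, f t = f 0 + k * t + 2^-1 * l * (t * t).
Proof.
move=> df t.
have H s : is_derive s (1 : R) (fun s => f s - 2^-1 * l * (s * s)) k.
  notypeclasses refine (is_derive_eq (is_derive_sub (df s)
    (is_derive_mul (is_derive_const s (2^-1 * l))
      (is_derive_mul (is_derive_self s) (is_derive_self s)))) _); lra.
have := linear_of_derive H t; lra.
Qed.

(** With tau = a0 + a1 t + a2 t^2 and chi = c1 + c2 t, the four functions below are tau, tau_t x / 2
    + chi, c4 - tau_t / 4 + c1 rho1 + c2 rho2 and tau_tt x^2 / 8 + chi_t x / 2 + c3. So c1, c2, c3,
    c4 are the coefficients of the two G-type generators, of M and of I. Squares are written as
    products, which [is_derive_rules] can differentiate. *)
Definition nfT (a0 a1 a2 : R) := fun t _ : R => a0 + a1 * t + a2 * (t * t).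
Definition nfX (a1 a2 c1 c2 : R) := fun t x : R =>
  2^-1 * (a1 + 2 * a2 * t) * x + (c1 + c2 * t).
Definition nfr (rho1 rho2 : R -> R) (a1 a2 c1 c2 c4 : R) := fun t _ : R =>
  c4 - 4^-1 * (a1 + 2 * a2 * t) + c1 * rho1 t + c2 * rho2 t.
Definition nfS (a2 c2 c3 : R) := fun _ x : R =>
  4^-1 * a2 * (x * x) + 2^-1 * c2 * x + c3.
Definition nf rho1 rho2 (a0 a1 a2 c1 c2 c3 c4 : R) a b :=
  affine_vf (nfT a0 a1 a2) (nfX a1 a2 c1 c2) (nfr rho1 rho2 a1 a2 c1 c2 c4)
    (nfS a2 c2 c3) a b.

Lemma dt_nfT a0 a1 a2 t x : dt (nfT a0 a1 a2) t x = a1 + 2 * a2 * t.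
Proof. notypeclasses refine (dtE _); rewrite /nfT; derive_by; ring. Qed.

Lemma dx_nfT a0 a1 a2 t x : dx (nfT a0 a1 a2) t x = 0.
Proof. by notypeclasses refine (dxE _); rewrite /nfT; is_derive_rules. Qed.

Lemma dt_nfX a1 a2 c1 c2 t x : dt (nfX a1 a2 c1 c2) t x = c2 + a2 * x.
Proof. notypeclasses refine (dtE _); rewrite /nfX; derive_by; lra. Qed.

Lemma dx_nfX a1 a2 c1 c2 t x : dx (nfX a1 a2 c1 c2) t x = 2^-1 * (a1 + 2 * a2 * t).
Proof. notypeclasses refine (dxE _); rewrite /nfX; derive_by; ring. Qed.

Lemma dt_nfS a2 c2 c3 t x : dt (nfS a2 c2 c3) t x = 0.
Proof. by notypeclasses refine (dtE _); rewrite /nfS; is_derive_rules. Qed.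

Lemma dx_nfS a2 c2 c3 t x : dx (nfS a2 c2 c3) t x = 2^-1 * (c2 + a2 * x).
Proof. notypeclasses refine (dxE _); rewrite /nfS; derive_by; lra. Qed.

Lemma dxx_nfS a2 c2 c3 t x : dx (dx (nfS a2 c2 c3)) t x = 2^-1 * a2.
Proof.
rewrite (_ : dx (nfS _ _ _) = fun _ x => 2^-1 * (c2 + a2 * x)).
  by notypeclasses refine (dxE _); derive_by; ring.
by apply/funext => s; apply/funext => y; rewrite dx_nfS.
Qed.

Lemma dx_nfr rho1 rho2 a1 a2 c1 c2 c4 t x : dx (nfr rho1 rho2 a1 a2 c1 c2 c4) t x = 0.
Proof. by notypeclasses refine (dxE _); rewrite /nfr; is_derive_rules. Qed.

Lemma dt_nfr gamma rho1 rho2 a1 a2 c1 c2 c4 t x :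
  (forall t : R, is_derive t 1 rho1 (- gamma t)) ->
  (forall t : R, is_derive t 1 rho2 (- (t * gamma t))) ->
  dt (nfr rho1 rho2 a1 a2 c1 c2 c4) t x = - (2^-1 * a2) - gamma t * (c1 + c2 * t).
Proof.
move=> /(_ t) h1 /(_ t) h2; notypeclasses refine (dtE _); rewrite /nfr.
by derive_by; lra.
Qed.

Definition classifying gamma (a0 a1 a2 : R) := forall t,
  derive1 gamma t * (a0 + a1 * t + a2 * (t * t))
  + 3 / 2 * gamma t * (a1 + 2 * a2 * t) = 0.

Lemma solve_determining gamma rho1 rho2 (T X r S : R -> R -> R) :
  (forall t : R, is_derive t 1 rho1 (- gamma t)) ->
  (forall t : R, is_derive t 1 rho2 (- (t * gamma t))) ->
  smooth2 T -> smooth2 X -> smooth2 r -> smooth2 S ->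
  (forall t x, dx T t x = 0) -> (forall t x, dx X t x = 2^-1 * dt T t x) ->
  (forall t x, dx r t x = 0) -> (forall t x, dx S t x = 2^-1 * dt X t x) ->
  (forall t x, dt S t x = 0) -> (forall t x, W_coef gamma T X r S t x = 0) ->
  exists a0 a1 a2 c1 c2 c3 c4, [/\ T = nfT a0 a1 a2, X = nfX a1 a2 c1 c2,
    r = nfr rho1 rho2 a1 a2 c1 c2 c4, S = nfS a2 c2 c3 & classifying gamma a0 a1 a2].
Proof.
move=> hr1 hr2 sT sX sr sS Tx Xx rx Sx St W0.
have zero2 (f : R -> R -> R) : (forall t x, f t x = 0) -> f = fun _ _ => 0.
  by move=> f0; apply/funext => t; apply/funext => x.
have dxX : dx X = fun t x => 2^-1 * dt T t x by apply/funext => t; apply/funext.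
have dxS : dx S = fun t x => 2^-1 * dt X t x by apply/funext => t; apply/funext.
have half (f : R -> R -> R) t x : smooth2 f ->
    dt (fun t x => 2^-1 * f t x) t x = 2^-1 * dt f t x.
  move=> sf; rewrite (@dtE _ (fun t x => 2^-1 * f t x) t x _
    (is_derive_mul (is_derive_const t (2^-1)) (is_derive_dt t x sf))).
  by rewrite mul0r add0r.
have two_neq0 : (2^-1 : R) != 0 by rewrite invr_eq0 pnatr_eq0.
(* X_tt / 2 is S_xt, the x-derivative of S_t = 0; T_ttt is then treated in the same way through
   X_x. *)
have Xtt t x : dt (dt X) t x = 0.
  apply: (mulfI two_neq0); rewrite mulr0 -(half _ _ _ (smooth2_dt sX)) -dxS.
  by rewrite (dt_dx sS) (zero2 _ St) dx_zero.
have Tttt t x : dt (dt (dt T)) t x = 0.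
  apply: (mulfI two_neq0); rewrite mulr0 -(half _ _ _ (smooth2_dt (smooth2_dt sT))).
  have -> : (fun t x => 2^-1 * dt (dt T) t x) = dt (dx X).
    by apply/funext => s; apply/funext => y; rewrite dxX half //; exact: smooth2_dt.
  by rewrite (dt_dx sX) (dt_dx (smooth2_dt sX)) (zero2 _ Xtt) dx_zero.
have cst_x (f : R -> R -> R) : smooth2 f -> (forall t x, dx f t x = 0) ->
    forall t x, f t x = f t 0.
  move=> sf f0 t x; apply: (@is_derive_0_is_cst _ (fun y => f t y) x 0) => y.
  exact: is_derive_dx_eq sf (f0 t y).
pose a0 := T 0 0; pose a1 := dt T 0 0; pose a2 := 2^-1 * dt (dt T) 0 0.
have Tt2 t : dt (dt T) t 0 = 2 * a2.
  have H s : is_derive s (1 : R) (fun s => dt (dt T) s 0) 0.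
    exact: is_derive_dt_eq (smooth2_dt (smooth2_dt sT)) (Tttt s 0).
  by rewrite (@is_derive_0_is_cst _ _ t 0 H) /a2 mulrA mulfV ?mul1r // pnatr_eq0.
have Tt1 t : dt T t 0 = a1 + 2 * a2 * t.
  apply: (@linear_of_derive (fun t => dt T t 0) (2 * a2)) => s.
  exact: is_derive_dt_eq (smooth2_dt sT) (Tt2 s).
have Tt0 t : T t 0 = a0 + a1 * t + a2 * (t * t).
  have H s : is_derive s (1 : R) (fun s => T s 0) (a1 + (2 * a2) * s).
    exact: is_derive_dt_eq sT (Tt1 s).
  rewrite (quadratic_of_derive H t) -/a0; lra.
have Ttx t x : dt T t x = a1 + 2 * a2 * t.
  refine (etrans (cst_x _ (smooth2_dt sT) _ t x) (Tt1 t)) => {}t {}x.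
  by rewrite -(dt_dx sT) (zero2 _ Tx) dt_zero.
pose c1 := X 0 0; pose c2 := dt X 0 0.
have Xt1 t : dt X t 0 = c2.
  have H s : is_derive s (1 : R) (fun s => dt X s 0) 0.
    exact: is_derive_dt_eq (smooth2_dt sX) (Xtt s 0).
  exact: (@is_derive_0_is_cst _ _ t 0 H).
have Xt0 t : X t 0 = c1 + c2 * t.
  apply: (@linear_of_derive (fun t => X t 0) c2) => s.
  exact: is_derive_dt_eq sX (Xt1 s).
have XE t x : X t x = nfX a1 a2 c1 c2 t x.
  have H y : is_derive y (1 : R) (fun y => X t y) (2^-1 * (a1 + 2 * a2 * t)).
    by notypeclasses refine (is_derive_dx_eq sX _); rewrite Xx Ttx.
  by rewrite (linear_of_derive H x) Xt0 /nfX addrC.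
have Xtx t x : dt X t x = c2 + a2 * x.
  have -> : X = nfX a1 a2 c1 c2 by apply/funext => s; apply/funext => y; exact: XE.
  exact: dt_nfX.
pose c3 := S 0 0.
have SE t x : S t x = nfS a2 c2 c3 t x.
  have H0 y : is_derive y (1 : R) (fun s => S s x) 0.
    exact: is_derive_dt_eq sS (St y x).
  rewrite (@is_derive_0_is_cst _ _ t 0 H0).
  have H y : is_derive y (1 : R) (fun y => S 0 y) (2^-1 * c2 + 2^-1 * a2 * y).
    by notypeclasses refine (is_derive_dx_eq sS _); rewrite Sx Xtx; ring.
  rewrite (quadratic_of_derive H x) /nfS -/c3; lra.
have Sxx t x : dx (dx S) t x = 2^-1 * a2.
  have -> : S = nfS a2 c2 c3 by apply/funext => s; apply/funext => y; exact: SE.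
  exact: dxx_nfS.
(* This is W = 0 at x = 0. *)
have rt0 t : dt r t 0 = - (2^-1 * a2) - gamma t * (c1 + c2 * t).
  have := W0 t 0; rewrite /W_coef Sxx Xt0 !mulr0 !addr0.
  by gen_atoms; move: (gamma t) => *; lra.
(* The value that makes [nfr] agree with [r] at t = 0; the primitives [rho1], [rho2] are not
   normalised there. *)
pose c4 := r 0 0 + 4^-1 * a1 - c1 * rho1 0 - c2 * rho2 0.
have rE t x : r t x = nfr rho1 rho2 a1 a2 c1 c2 c4 t x.
  rewrite (cst_x _ sr rx).
  have H s : is_derive s (1 : R)
     (fun s => r s 0 - (c1 * rho1 s + c2 * rho2 s)) (- (2^-1 * a2)).
    notypeclasses refine (is_derive_eq (is_derive_sub (is_derive_dt s 0 sr)
      (is_derive_add (is_derive_mul (is_derive_const s c1) (hr1 s))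
      (is_derive_mul (is_derive_const s c2) (hr2 s)))) _).
    by rewrite rt0; ring.
  have := linear_of_derive H t; rewrite /nfr /c4.
  move: (r t 0) (r 0 0) (rho1 t) (rho1 0) (rho2 t) (rho2 0) => *.
  lra.
exists a0, a1, a2, c1, c2, c3, c4; split.
- by apply/funext => t; apply/funext => x; rewrite (cst_x _ sT Tx) Tt0.
- by apply/funext => t; apply/funext => x.
- by apply/funext => t; apply/funext => x.
- by apply/funext => t; apply/funext => x.
(* The constant part of W is known to vanish, so W at x = 1 is the coefficient of x. In it 3/2 is 1
   from tau_t gamma x plus 1/2 from gamma xi. *)
- move=> t; have := W0 t 1; rewrite /W_coef Sxx Ttx (cst_x _ sT Tx) Tt0 XE /nfX.
  have -> : dt r t 1 = dt r t 0.
    apply: (cst_x _ (smooth2_dt sr)) => s y.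
    by rewrite -(dt_dx sr) (zero2 _ rx) dt_zero.
  rewrite rt0; gen_atoms; move: (gamma t) => g E.
  lra.
Qed.

End Solve.

(** * The condition on tau *)

Section OneVariable.
Variable R : realType.
Implicit Types (g : R -> R).

Lemma smooth1_is_derive g (t : R) : smooth1 g -> is_derive t (1 : R) g (derive1 g t).
Proof.
move=> sg; apply: (@derivable_slice _ _ _ g 0 (pt 0 [:: t]) t sg) => h.
by rewrite !cmp_line // !cmp_pt.
Qed.

Lemma smooth1_derive1 g : smooth1 g -> smooth1 (derive1 g).
Proof.
move=> sg; have := smoothn_derive (inord 0) sg.
rewrite (_ : 'D__ _ = fun p => derive1 g (cmp p 0)) //.
by apply/funext => p; apply: derive_slice => h; rewrite !cmp_line.
Qed.

(** The functions [rho1], [rho2] are given only by their derivatives, so their smoothness must be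
    derived. No induction is involved: the derivative of [G] is [g], already of class k. *)
Lemma smooth1_primitive g (G : R -> R) : smooth1 g ->
  (forall t : R, is_derive t (1 : R) G (g t)) -> smooth1 G.
Proof.
move=> sg dG k.
suff H : Ck k.+1 (fun p : 'rV[R]_1 => G (cmp p 0)) by exact: CkW.
have Di (i : 'I_1) : delta_mx 0 i = delta_mx 0 (inord 0) :> 'rV[R]_1.
  by rewrite (ord1 i); congr delta_mx; apply/val_inj; rewrite /= inordK.
split.
- move=> p; have cG : {for cmp p 0, continuous G}.
    apply: differentiable_continuous; apply/derivable1_diffP.
    by have [] := dG (cmp p 0).
  exact: (cvg_comp _ _ (@coord_continuous _ _ _ ord0 (inord 0) p) cG).
- move=> i p; rewrite Di; have [+ _] := dG (cmp p 0); rewrite /derivable.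
  set g1 := fun h => h^-1 *: _; set g2 := fun h => h^-1 *: _.
  suff -> : g1 = g2 by [].
  by rewrite funeqE /g1 /g2 => h /=; rewrite cmp_line // [h *: 1]mulr1.
- move=> i; rewrite Di (_ : 'D__ _ = fun p => g (cmp p 0)); first exact: sg.
  apply/funext => p; rewrite (@derive_slice _ _ _ G 0 p (cmp p 0)).
    exact: derive1_eq.
  by move=> h; rewrite cmp_line.
Qed.

(** One formula covers all signs because [Num.sg 0 = 0]. At 0 the difference quotient has absolute
    value [Num.sqrt] of [|h|], which tends to 0. *)
Lemma is_derive_norm_powR (y : R) :
  is_derive y (1 : R) (fun y => `|y| `^ (3 / 2)) (3 / 2 * Num.sg y * `|y| `^ (2^-1)).
Proof.
have e32 : 3 / 2 - 1 = 2^-1 :> R by lra.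
have [y0|y0|->] := ltrgt0P y.
- have H : is_derive y (1 : R) (fun y => `|y| `^ (3 / 2)) (3 / 2 * y `^ (3 / 2 - 1)).
    refine (near_eq_is_derive _ (is_derive1_powR (3 / 2) y0)).
    by near=> z; rewrite gtr0_norm //; near: z; exact: lt_nbhsr.
  by notypeclasses refine (is_derive_eq H _); rewrite gtr0_sg // mulr1 e32.
- have ny0 : 0 < - y by rewrite oppr_gt0.
  have H : is_derive y (1 : R) (fun y => `|y| `^ (3 / 2))
      (3 / 2 * (- y) `^ (3 / 2 - 1) * - 1).
    refine (near_eq_is_derive _ (is_derive1_comp (is_derive1_powR (3 / 2) ny0)
      (is_deriveNid y (1 : R)))).
    by near=> z; rewrite /= ltr0_norm //; near: z; exact: lt_nbhsl.
  notypeclasses refine (is_derive_eq H _).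
  by rewrite ltr0_sg // e32 mulrAC.
- rewrite sgr0 mulr0 mul0r.
  have lim : h^-1 *: (`|h *: (1 : R) + 0| `^ (3 / 2) - `|0 : R| `^ (3 / 2))
      @[h --> (0 : R)^'] --> (0 : R).
    have sqrt0 : Num.sqrt `|h| @[h --> (0 : R)^'] --> (0 : R).
      have c : {for (0 : R), continuous (fun h : R => Num.sqrt `|h|)}.
        apply: (@continuous_comp _ _ _ (fun h : R => `|h|) Num.sqrt).
          exact: norm_continuous.
        exact: sqrt_continuous.
      have : Num.sqrt `|h| @[h --> (0 : R)^'] --> Num.sqrt `|0 : R|.
        exact: cvg_within_filter c.
      by rewrite normr0 sqrtr0.
    have nsqrt0 : - Num.sqrt `|h| @[h --> (0 : R)^'] --> (0 : R).
      have : - Num.sqrt `|h| @[h --> (0 : R)^'] --> - (0 : R) by apply: cvgN.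
      by rewrite oppr0.
    apply: (@squeeze_cvgr _ _ _ _ (fun h => - Num.sqrt `|h|) (fun h => Num.sqrt `|h|)) => //.
    near=> h; rewrite -ler_norml.
    have h0 : h != 0 by near: h; exact: nbhs_dnbhs_neq.
    rewrite addr0 normr0 powR0; last by rewrite mulf_neq0 ?invr_eq0 ?pnatr_eq0.
    rewrite subr0 [h *: 1]mulr1 normrM normfV (ger0_norm (powR_ge0 _ _)).
    rewrite -(@mulr_powRB1 _ `|h| (3 / 2)) //.
    by rewrite mulrA mulVf ?normr_eq0 // mul1r e32 powR12_sqrt.
  by apply: DeriveDef; [apply: cvgP lim|apply/cvg_lim].
Unshelve. all: by end_near. Qed.

(** Writing |tau|^(3/2) = tau sg(tau) |tau|^(1/2), also valid at tau = 0, lets the factor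
    |tau|^(1/2) sg(tau) be taken out of both terms of the product rule. *)
Lemma is_derive_classifying g (tau : R -> R) (t g' tau' : R) :
  is_derive t (1 : R) g g' -> is_derive t (1 : R) tau tau' ->
  is_derive t (1 : R) (fun s => g s * `|tau s| `^ (3 / 2))
    (`|tau t| `^ (2^-1) * Num.sg (tau t) * (g' * tau t + 3 / 2 * g t * tau')).
Proof.
move=> dg dtau.
have dn := is_derive1_comp (is_derive_norm_powR (tau t)) dtau.
notypeclasses refine (is_derive_eq (is_derive_mul dg dn) _) => /=.
have -> : `|tau t| `^ (3 / 2) = tau t * Num.sg (tau t) * `|tau t| `^ (2^-1).
  rewrite -(@mulr_powRB1 _ `|tau t| (3 / 2)) //.
  have -> : 3 / 2 - 1 = 2^-1 :> R by lra.
  by congr (_ * _); rewrite mulrC -normrEsg.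
by move: (`|tau t| `^ 2^-1) (Num.sg (tau t)) (tau t) (g t) => n sgt ta ga; ring.
Qed.

Lemma horner_size3 (tau : {poly R}) (t : R) : (size tau <= 3)%N ->
  [/\ tau.[t] = tau`_0 + tau`_1 * t + tau`_2 * (t * t),
      (deriv tau).[t] = tau`_1 + 2 * tau`_2 * t & (derivn 2 tau).[t] = 2 * tau`_2].
Proof.
move=> s3; have sz (p : {poly R}) : (size p <= 3)%N -> p.[t] = p`_0 + p`_1 * t + p`_2 * (t * t).
  move=> /(horner_coef_wide t) ->; rewrite !big_ord_recl big_ord0 /= /bump /=.
  by rewrite expr0 mulr1 addr0 expr1 addrA.
have c3 i : (3 <= i)%N -> tau`_i = 0 by move=> i3; rewrite nth_default // (leq_trans s3).
have sd (p : {poly R}) : (size p <= 3)%N -> (size (deriv p) <= 3)%N.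
  by move=> p3; apply: leq_trans (size_poly _ _) (leq_trans (leq_pred _) p3).
split; first exact: sz.
  by rewrite sz ?sd // !coef_deriv (c3 3%N) // mul0rn; ring.
rewrite /= sz ?sd // !coef_deriv (c3 3%N) // (c3 4%N) // !mul0rn; ring.
Qed.

(** The derivative of gamma |tau|^(3/2) is a factor vanishing exactly at the zeros of tau, times the
    classifying expression [w]. Thus [w = 0] away from these zeros, the product [w * q] vanishes
    everywhere, and only the zeros need a separate argument. *)
Lemma admissible_classifying g (tau : {poly R}) : smooth1 g -> (size tau <= 3)%N ->
  admissible_tau g tau <-> classifying g tau`_0 tau`_1 tau`_2.
Proof.
move=> sg s3; set a0 := tau`_0; set a1 := tau`_1; set a2 := tau`_2.
have E t : tau.[t] = a0 + a1 * t + a2 * (t * t) by have [] := horner_size3 t s3.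
pose q t := a0 + a1 * t + a2 * (t * t).
have dq t : is_derive t (1 : R) q (a1 + 2 * a2 * t) by rewrite /q; derive_by; ring.
have D t := is_derive_classifying (smooth1_is_derive t sg) (dq t).
have Ef : (fun s => g s * `|tau.[s]| `^ (3 / 2)) = (fun s => g s * `|q s| `^ (3 / 2)).
  by apply/funext => s; rewrite E.
split=> [[_ adm] t|cl]; last first.
  split=> // t; rewrite Ef; notypeclasses refine (is_derive_eq (D t) _).
  by rewrite (cl t) mulr0.
pose w t := derive1 g t * q t + 3 / 2 * g t * (a1 + 2 * a2 * t).
have wq s : w s * q s = 0.
  have := adm s; rewrite Ef => -[_ e1]; have [_ e2] := D s.
  have [->|q0] := eqVneq (q s) 0; first by rewrite mulr0.
  have /eqP : `|q s| `^ 2^-1 * Num.sg (q s) * w s = 0 by rewrite -e2.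
  rewrite !mulf_eq0 sgr_eq0 (negbTE q0) orbF powR_eq0 normr_eq0 (negbTE q0) /=.
  by move=> /eqP ->; rewrite mul0r.
(* At a zero of q where q' <> 0, differentiating w q = 0 gives w = 0. *)
have dg := smooth1_is_derive t sg.
have dg1 := smooth1_is_derive t (smooth1_derive1 sg).
have dqt := dq t.
(* Only the existence of [w'] matters: it is multiplied by [q t], which is 0 where this is used. *)
have [w' dw] : exists w', is_derive t (1 : R) w w'.
  eexists; rewrite /w; is_derive_rules.
have dwq := is_derive_mul dw dqt.
have e0 : w' * q t + w t * (a1 + 2 * a2 * t) = 0.
  rewrite -(derive1_eq dwq) (_ : (fun y => _) = fun=> 0); last exact/funext.
  exact: derive1_eq (is_derive_const t 0).
have [q0|q0] := eqVneq (q t) 0; last first.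
  by have /eqP := wq t; rewrite mulf_eq0 (negbTE q0) orbF => /eqP.
(* At a common zero of tau and tau_t both terms of the classifying expression vanish. *)
have [p0|p0] := eqVneq (a1 + 2 * a2 * t) 0.
  by rewrite -/(q t) q0 p0 !mulr0 addr0.
by move: e0 => /eqP; rewrite q0 mulr0 add0r mulf_eq0 (negbTE p0) orbF => /eqP.
Qed.

End OneVariable.

(** * Normal form and span *)

Section Main.
Variable R : realType.
Variables gamma rho1 rho2 : R -> R.
Hypothesis sg : smooth1 gamma.
Hypothesis hr1 : forall t : R, is_derive t 1 rho1 (- gamma t).
Hypothesis hr2 : forall t : R, is_derive t 1 rho2 (- (t * gamma t)).
Implicit Types (P Q : vfield R).

Definition normal_form Q := exists a0 a1 a2 c1 c2 c3 c4 a b,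
  [/\ classifying gamma a0 a1 a2, smooth2 a, smooth2 b, is_solution gamma a b &
      Q = nf rho1 rho2 a0 a1 a2 c1 c2 c3 c4 a b].

Lemma lie_symmetryP Q : lie_symmetry gamma Q <-> normal_form Q.
Proof.
split=> [LQ|[a0 [a1 [a2 [c1 [c2 [c3 [c4 [a [b [cl sa sb sol ->]]]]]]]]]]].
- have [T [X [r [S [a [b [QE [[sT sX sr sS] [sa [sb [Tx Xx rx Sx]]]]]]]]]]] :=
    symmetry_affine LQ.
  rewrite QE in LQ.
  have [St W0 sol] := (affine_symmetryP _ sT sX sr sS sa sb Tx Xx rx Sx).1 LQ.
  have [a0 [a1 [a2 [c1 [c2 [c3 [c4 [TE XE rE SE cl]]]]]]]] :=
    solve_determining hr1 hr2 sT sX sr sS Tx Xx rx Sx St W0.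
  exists a0, a1, a2, c1, c2, c3, c4, a, b; split=> //.
  by rewrite QE TE XE rE SE.
- have s1 : smooth1 rho1.
    by apply: smooth1_primitive hr1; rewrite /smooth1; smooth_rules.
  have s2 : smooth1 rho2.
    by apply: smooth1_primitive hr2; rewrite /smooth1; smooth_rules.
  apply/affine_symmetryP => //.
  + by rewrite /nfT; smooth_rules.
  + by rewrite /nfX; smooth_rules.
  + by rewrite /nfr; smooth_rules.
  + by rewrite /nfS; smooth_rules.
  + exact: dx_nfT.
  + by move=> t x; rewrite dx_nfX dt_nfT.
  + exact: dx_nfr.
  + by move=> t x; rewrite dx_nfS dt_nfX.
  + split=> //; first exact: dt_nfS.
    move=> t x; rewrite /W_coef (dt_nfr _ _ _ _ _ _ _ hr1 hr2) dxx_nfS dt_nfT /nfT /nfX.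
    have := cl t; move: (derive1 gamma t) (gamma t) => g' g E.
    (* W is exactly x times the classifying expression, so 0 is rewritten as x times the latter. *)
    rewrite -[RHS](mulr0 x) -E; lra.
Qed.

Lemma vf_eq P Q :
  (forall t x p q, [/\ vf_t P t x p q = vf_t Q t x p q, vf_x P t x p q = vf_x Q t x p q,
    vf_u P t x p q = vf_u Q t x p q & vf_v P t x p q = vf_v Q t x p q]) -> P = Q.
Proof.
by case: P Q => [????] [????] /= E; congr VF; apply: fun4_eq => t x p q; have [] := E t x p q.
Qed.

Lemma dt_lin c (f g : R -> R -> R) t x : smooth2 f -> smooth2 g ->
  dt (fun t x => c * f t x + g t x) t x = c * dt f t x + dt g t x.
Proof.
move=> sf sg'; rewrite (@dtE _ (fun t x => c * f t x + g t x) t x _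
  (is_derive_add (is_derive_mul (is_derive_const t c) (is_derive_dt t x sf))
    (is_derive_dt t x sg'))).
by rewrite mul0r add0r.
Qed.

Lemma dx_lin c (f g : R -> R -> R) : smooth2 f -> smooth2 g ->
  dx (fun t x => c * f t x + g t x) = fun t x => c * dx f t x + dx g t x.
Proof.
move=> sf sg'; apply/funext => t; apply/funext => x.
rewrite (@dxE _ (fun t x => c * f t x + g t x) t x _
  (is_derive_add (is_derive_mul (is_derive_const x c) (is_derive_dx t x sf))
    (is_derive_dx t x sg'))).
by rewrite mul0r add0r.
Qed.

(** The family is linear in all its parameters, and the conditions on them, [classifying] and
    [is_solution], are linear and homogeneous. *)
Lemma normal_form_lin c P Q : normal_form P -> normal_form Q ->
  normal_form (vf_add (vf_scale c P) Q).
Proof.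
move=> [a0 [a1 [a2 [c1 [c2 [c3 [c4 [a [b [cl sa sb sol ->]]]]]]]]]].
move=> [a0' [a1' [a2' [c1' [c2' [c3' [c4' [a' [b' [cl' sa' sb' sol' ->]]]]]]]]]].
exists (c * a0 + a0'), (c * a1 + a1'), (c * a2 + a2'), (c * c1 + c1'),
  (c * c2 + c2'), (c * c3 + c3'), (c * c4 + c4'),
  (fun t x => c * a t x + a' t x), (fun t x => c * b t x + b' t x); split.
- move=> t; refine (etrans _ (etrans (congr2 (fun u v => c * u + v) (cl t) (cl' t)) _)).
    by move: (derive1 gamma t) (gamma t) => *; ring.
  by rewrite mulr0 addr0.
- by smooth_rules.
- by smooth_rules.
- move=> t x; have [e1 e2] := sol t x; have [e1' e2'] := sol' t x.
  split.
    transitivity (c * Delta1 gamma a b t x + Delta1 gamma a' b' t x); last first.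
      by rewrite e1 e1' mulr0 addr0.
    rewrite /Delta1 dt_lin // dx_lin // dx_lin; try exact: smooth2_dx.
    by gen_atoms; ring.
  transitivity (c * Delta2 gamma a b t x + Delta2 gamma a' b' t x); last first.
    by rewrite e2 e2' mulr0 addr0.
  rewrite /Delta2 dt_lin // dx_lin // dx_lin; try exact: smooth2_dx.
  by gen_atoms; ring.
- apply: vf_eq => t x p q; rewrite /= /nfT /nfX /nfr /nfS.
  by split; ring.
Qed.

Lemma zero_solution : is_solution gamma (fun _ _ => 0) (fun _ _ => 0).
Proof.
have dx0 : dx (fun _ _ : R => 0 : R) = fun _ _ => 0.
  by apply/funext => t; apply/funext => x; exact: dx_zero.
by move=> t x; rewrite /Delta1 /Delta2 !dx0 dt_zero; split; ring.
Qed.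

Lemma smooth2_zero : smooth2 (fun _ _ : R => 0 : R).
Proof. by smooth_rules. Qed.

Lemma classifying0 : classifying gamma 0 0 0.
Proof. by move=> t; ring. Qed.

Lemma normal_form0 : normal_form (vf_zero R).
Proof.
exists 0, 0, 0, 0, 0, 0, 0, (fun _ _ => 0), (fun _ _ => 0).
split; [exact: classifying0|exact: smooth2_zero..|exact: zero_solution|].
by apply: vf_eq => t x p q; rewrite /= /nfT /nfX /nfr /nfS; split; ring.
Qed.

Lemma normal_form_gens Q : gens gamma rho1 rho2 Q -> normal_form Q.
Proof.
have s0 := smooth2_zero; have z0 := zero_solution; have k0 := classifying0.
case=> [[tau [adm ->]]|[->|[->|[->|[->|[a [b [sa sb sol ->]]]]]]]].
- have s3 := adm.1; have cl := (admissible_classifying sg s3).1 adm.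
  exists tau`_0, tau`_1, tau`_2, 0, 0, 0, 0, (fun _ _ => 0), (fun _ _ => 0).
  split=> //; apply: vf_eq => t x p q; rewrite /= /nfT /nfX /nfr /nfS.
  have [h0 h1 h2] := horner_size3 t s3; rewrite /= in h2; rewrite h0 h1 h2.
  by split; field.
- exists 0, 0, 0, 1, 0, 0, 0, (fun _ _ => 0), (fun _ _ => 0); split=> //.
  apply: vf_eq => t x p q; rewrite /= /nfT /nfX /nfr /nfS.
  by rewrite (derive1_eq (is_derive_const t 1)); split; field.
- exists 0, 0, 0, 0, 1, 0, 0, (fun _ _ => 0), (fun _ _ => 0); split=> //.
  apply: vf_eq => t x p q; rewrite /= /nfT /nfX /nfr /nfS.
  by rewrite (derive1_eq (is_derive_self t)); split; field.
- exists 0, 0, 0, 0, 0, 1, 0, (fun _ _ => 0), (fun _ _ => 0); split=> //.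
  by apply: vf_eq => t x p q; rewrite /= /nfT /nfX /nfr /nfS; split; ring.
- exists 0, 0, 0, 0, 0, 0, 1, (fun _ _ => 0), (fun _ _ => 0); split=> //.
  by apply: vf_eq => t x p q; rewrite /= /nfT /nfX /nfr /nfS; split; ring.
- exists 0, 0, 0, 0, 0, 0, 0, a, b; split=> //.
  by apply: vf_eq => t x p q; rewrite /= /nfT /nfX /nfr /nfS; split; ring.
Qed.

Lemma in_span_normal_form Q : in_span (gens gamma rho1 rho2) Q <-> normal_form Q.
Proof.
split=> [[s [+ ->]]|[a0 [a1 [a2 [c1 [c2 [c3 [c4 [a [b [cl sa sb sol ->]]]]]]]]]]].
  elim: s => [_|[c P] s IH /= [gP gs]]; first exact: normal_form0.
  by apply: normal_form_lin; [exact: normal_form_gens|exact: IH].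
pose tau : {poly R} := Poly [:: a0; a1; a2].
have s3 : (size tau <= 3)%N by apply: size_Poly.
have [t0 t1 t2] : [/\ tau`_0 = a0, tau`_1 = a1 & tau`_2 = a2].
  by rewrite !coef_Poly.
have adm : admissible_tau gamma tau.
  by apply/(admissible_classifying sg s3); rewrite t0 t1 t2.
(* The coefficients of [D_vf] and [Z_vf] are 1 because the parameters [tau] and [(a, b)] already
   absorb scalars. *)
exists [:: (1, D_vf tau); (c1, vf_add (G_vf (fun _ => 1)) (vf_mulf rho1 (I_vf R)));
  (c2, vf_add (G_vf id) (vf_mulf rho2 (I_vf R))); (c3, M_vf R); (c4, I_vf R);
  (1, Z_vf a b)]; split.
  rewrite /= /gens; split; first by left; exists tau.
  split; first by right; left.
  split; first by right; right; left.
  split; first by right; right; right; left.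
  split; first by right; right; right; right; left.
  by split=> //; right; right; right; right; right; exists a, b.
apply: vf_eq => t x p q; rewrite /= /nfT /nfX /nfr /nfS.
have [h0 h1 h2] := horner_size3 t s3; rewrite /= in h2; rewrite h0 h1 h2 t0 t1 t2.
rewrite (derive1_eq (is_derive_const t 1)) (derive1_eq (is_derive_self t)).
by split; field.
Qed.

End Main.

Theorem theorem7 (R : realType) (gamma rho1 rho2 : R -> R) :
  smooth1 gamma ->
  (forall t : R, is_derive t 1 rho1 (- gamma t)) ->
  (forall t : R, is_derive t 1 rho2 (- (t * gamma t))) ->
  forall Q : vfield R, lie_symmetry gamma Q <-> in_span (gens gamma rho1 rho2) Q.
Proof.
move=> sg hr1 hr2 Q.
have symP := lie_symmetryP sg hr1 hr2 Q.
have spanP := in_span_normal_form rho1 rho2 sg Q.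
by split=> [/symP/spanP|/spanP/symP].
Qed.
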